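(* Assume the standing assumptions stated in the context. Let $\{X_k\}_{k\ge 0}$ be generated by the fixed-point iteration described in the context, started from $X_0=0$ (with each frozen continuous-time algebraic Riccati equation solved exactly for its stabilizing solution). Then the following statements hold. (i) $0=X_0\preceq X_1\preceq\cdots\preceq X_k\preceq X_*$, $\mathscr{R}(X_k)\succeq 0$, and $\operatorname{eig}(A_k-G_kX_* )\subset\mathbb{C}_-$ for all $k\ge 0$, where $A_k=A_{c}(X_k)$ and $G_k=G_{c}(X_k)$; (ii) $0\preceq\lim_{k\rightarrow \infty}X_k=X_{*}$ and $\operatorname{eig}\left(A_{c}(X_{*})-G_{c}(X_{*})X_{*}\right)\subset \mathbb{C}_-\cup \iota\mathbb{R}$.
   Context: Let $A\in\mathbb{R}^{n\times n}$, $B\in\mathbb{R}^{n\times m}$, $Q=Q^{T}\in\mathbb{R}^{n\times n}$, $L\in\mathbb{R}^{n\times m}$, $R=R^{T}\in\mathbb{R}^{m\times m}$, and $A_0^i\in\mathbb{R}^{n\times n}$, $B_0^i\in\mathbb{R}^{n\times m}$ for $i=1,\dots,r$; write $A_0^0=A$, $B_0^0=B$. For symmetric $X$ define $\Pi_{11}(X)=\sum_{i=1}^r (A_0^i)^{T}XA_0^i$, $\Pi_{12}(X)=\sum_{i=1}^r (A_0^i)^{T}XB_0^i$, $\Pi_{22}(X)=\sum_{i=1}^r (B_0^i)^{T}XB_0^i$, and $L_c(X)=L+\Pi_{12}(X)$, $R_c(X)=R+\Pi_{22}(X)$, $Q_c(X)=Q+\Pi_{11}(X)$, $A_c(X)=A-BR_c(X)^{-1}L_c(X)^{T}$,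 $G_c(X)=BR_c(X)^{-1}B^{T}$, $H_c(X)=Q_c(X)-L_c(X)R_c(X)^{-1}L_c(X)^{T}$. The stochastic continuous-time algebraic Riccati equation is $\mathscr{R}(X):=A_c(X)^{T}X+XA_c(X)-XG_c(X)X+H_c(X)=0$ (equivalently $A^{T}X+XA+Q+\Pi_{11}(X)-[XB+L+\Pi_{12}(X)][R+\Pi_{22}(X)]^{-1}[XB+L+\Pi_{12}(X)]^{T}=0$). $\mathbb{C}_-$ is the open left half complex plane, $\iota$ the imaginary unit, $\preceq$ the Loewner order. Standing assumptions: $R\succ 0$ and $\begin{bmatrix}Q&L\\L^{T}&R\end{bmatrix}\succeq 0$; $\mathcal{N}(Q-LR^{-1}L^{T})\subseteq \mathcal{N}(L)\cap\bigcap_{i=1}^r\mathcal{N}(A_0^i)$; $(A,B)$ is stabilizable and $(Q-LR^{-1}L^{T},A)$ is detectable; the pair $(\{A_0^i\}_{i=0}^r,\{B_0^i\}_{i=0}^r)$ is (mean-square) stabilizable, i.e. there is $F$ such that $\dot S=(A+BF)S+S(A+BF)^{T}+\sum_{i=1}^r(A_0^i+B_0^iF)S(A_0^i+B_0^iF)^{T}$ is exponentially stable; and with $C^{T}C=Q-LR^{-1}L^{T}$ and $\widetilde A_0^i=A_0^i-B_0^iR^{-1}L^{T}$, the pair $(C,\{\widetilde A_0^i\}_{i=0}^r)$ is detectable, i.e. there is $K$ such that $\dot S=(\widetilde A_0^0+KC)S+S(\widetilde A_0^0+KC)^{T}+\sum_{i=1}^r\widetilde A_0^iS(\widetilde A_0^i)^{T}$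 is exponentially stable. Under these assumptions the equation $\mathscr{R}(X)=0$ has a unique positive semidefinite solution $X_*$, which is also stabilizing. Iteration: given $X_k\succeq 0$, set $A_k=A_c(X_k)$, $G_k=G_c(X_k)$, $H_k=H_c(X_k)$ and let $X_{k+1}$ be the stabilizing solution of the (frozen-coefficient) continuous-time algebraic Riccati equation $A_k^{T}X+XA_k-XG_kX+H_k=0$ (computed in practice by the structure-preserving doubling algorithm). *)

(* Defs.v *)
From HB Require Import structures.
From mathcomp Require Import all_boot all_order all_algebra.
From mathcomp Require Import all_classical all_reals.
From mathcomp Require Import topology normedtype sequences derive exp.
From mathcomp Require Import complex.
Set Implicit Arguments. Unset Strict Implicit. Unset Printing Implicit Defensive.
Import Order.TTheory GRing.Theory Num.Theory.
Import numFieldNormedType.Exports.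
Local Open Scope ring_scope.

Section Defs.
Variable R : realType.

Definition cmx (p q : nat) (M : 'M[R]_(p, q)) : 'M[R[i]]_(p, q) :=
  map_mx (fun x : R => (x%:C)%C) M.

Definition eig_in_Cminus (p : nat) (M : 'M[R]_p) : Prop :=
  forall lam : R[i], eigenvalue (cmx M) lam -> complex.Re lam < 0.

Definition eig_in_Cminus_or_iR (p : nat) (M : 'M[R]_p) : Prop :=
  forall lam : R[i], eigenvalue (cmx M) lam -> complex.Re lam <= 0.

Definition symmetric (p : nat) (M : 'M[R]_p) : Prop := M^T = M.

Definition psd (p : nat) (M : 'M[R]_p) : Prop :=
  symmetric M /\ forall v : 'cV[R]_p, 0 <= (v^T *m M *m v) 0 0.

Definition pd (p : nat) (M : 'M[R]_p) : Prop :=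
  symmetric M /\ forall v : 'cV[R]_p, v != 0 -> 0 < (v^T *m M *m v) 0 0.

Definition loewner_le (p : nat) (X Y : 'M[R]_p) : Prop := psd (Y - X).

Definition mxnorm1 (p q : nat) (M : 'M[R]_(p, q)) : R :=
  \sum_(i < p) \sum_(j < q) `|M i j|.

Definition exp_stable_ode (p : nat) (Lop : 'M[R]_p -> 'M[R]_p) : Prop :=
  exists c a : R, 0 < c /\ 0 < a /\
    forall S : R -> 'M[R]_p,
      (forall (t : R) (i j : 'I_p),
          derivable (fun s : R => S s i j) t 1 /\
          derive1 (fun s : R => S s i j) t = Lop (S t) i j) ->
      forall t : R, 0 <= t -> mxnorm1 (S t) <= c * expR (- (a * t)) * mxnorm1 (S 0).

Variables (n m r : nat).
Variables (A : 'M[R]_n) (B : 'M[R]_(n, m)) (Q : 'M[R]_n) (L : 'M[R]_(n, m))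
  (Rm : 'M[R]_m) (A0 : 'I_r -> 'M[R]_n) (B0 : 'I_r -> 'M[R]_(n, m)).

Definition Pi11 (X : 'M[R]_n) : 'M[R]_n := \sum_(i < r) (A0 i)^T *m X *m A0 i.
Definition Pi12 (X : 'M[R]_n) : 'M[R]_(n, m) := \sum_(i < r) (A0 i)^T *m X *m B0 i.
Definition Pi22 (X : 'M[R]_n) : 'M[R]_m := \sum_(i < r) (B0 i)^T *m X *m B0 i.

Definition Lc (X : 'M[R]_n) := L + Pi12 X.
Definition Rc (X : 'M[R]_n) := Rm + Pi22 X.
Definition Qc (X : 'M[R]_n) := Q + Pi11 X.
Definition Ac (X : 'M[R]_n) : 'M[R]_n := A - B *m invmx (Rc X) *m (Lc X)^T.
Definition Gc (X : 'M[R]_n) : 'M[R]_n := B *m invmx (Rc X) *m B^T.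
Definition Hc (X : 'M[R]_n) : 'M[R]_n := Qc X - Lc X *m invmx (Rc X) *m (Lc X)^T.

Definition Ric (X : 'M[R]_n) : 'M[R]_n :=
  (Ac X)^T *m X + X *m Ac X - X *m Gc X *m X + Hc X.

Definition frozen_stabilizing_sol (Ak Gk Hk X : 'M[R]_n) : Prop :=
  symmetric X /\
  Ak^T *m X + X *m Ak - X *m Gk *m X + Hk = 0 /\
  eig_in_Cminus (Ak - Gk *m X).

Definition fp_iteration (X : nat -> 'M[R]_n) : Prop :=
  X 0%N = 0 /\
  forall k : nat, frozen_stabilizing_sol (Ac (X k)) (Gc (X k)) (Hc (X k)) (X k.+1).

Definition ms_stabilizable : Prop :=
  exists F : 'M[R]_(m, n),
    exp_stable_ode (fun S : 'M[R]_n =>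
      (A + B *m F) *m S + S *m (A + B *m F)^T
      + \sum_(i < r) (A0 i + B0 i *m F) *m S *m (A0 i + B0 i *m F)^T).

Definition ms_detectable (p : nat) (C : 'M[R]_(p, n)) : Prop :=
  exists K : 'M[R]_(n, p),
    exp_stable_ode (fun S : 'M[R]_n =>
      (A - B *m invmx Rm *m L^T + K *m C) *m S
      + S *m (A - B *m invmx Rm *m L^T + K *m C)^T
      + \sum_(i < r) (A0 i - B0 i *m invmx Rm *m L^T) *m S
                       *m (A0 i - B0 i *m invmx Rm *m L^T)^T).

Definition standing_assumptions : Prop :=
  symmetric Q /\ symmetric Rm /\
  pd Rm /\
  psd (block_mx Q L L^T Rm) /\
  (forall v : 'cV[R]_n, (Q - L *m invmx Rm *m L^T) *m v = 0 ->
      L^T *m v = 0 /\ forall i : 'I_r, A0 i *m v = 0) /\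
  (exists F : 'M[R]_(m, n), eig_in_Cminus (A + B *m F)) /\
  (exists K : 'M[R]_n, eig_in_Cminus (A + K *m (Q - L *m invmx Rm *m L^T))) /\
  ms_stabilizable.

End Defs.

(* Main.v *)
(** Completing the square, for every feedback F the frozen Riccati operator is
    the Lyapunov operator of the loop A + B F, plus the cost of F, minus a
    square that vanishes at the optimal gain.  Evaluating two such identities
    along one stabilising gain turns each comparison (X_k <= X_(k+1),
    X_(k+1) <= X_*, R(X_(k+1)) >= 0) into a Lyapunov inequality.  The monotone
    limit solves R(X) = 0; detectability makes its closed loop mean-square
    stable, hence it dominates every positive semidefinite solution and equals
    X_*.

    Stability enters through a Perron theorem for S |-> A^T S + S A + sum N^T S N:
    either there is a positive definite P mapped to a negative definite matrix,
    or there is a nonzero positive semidefinite eigenvector with eigenvalue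
    lam >= 0.  Detectability rules out the second alternative, because such an
    eigenvector of the dual operator must have zero cost. *)
Require Import Defs.
From HB Require Import structures.
From mathcomp Require Import all_boot all_order all_algebra.
From mathcomp Require Import all_classical all_reals.
From mathcomp Require Import topology normedtype sequences derive exp.
From mathcomp Require Import complex.
From mathcomp Require Import spectral realfun ring lra.
Set Implicit Arguments. Unset Strict Implicit. Unset Printing Implicit Defensive.
Import Order.TTheory GRing.Theory Num.Theory.
Import numFieldNormedType.Exports.
Local Open Scope ring_scope.
Local Open Scope classical_set_scope.

(* [ring] on matrix entries: matrix products are abstracted first, so this
   proves identities of abelian groups, and of modules over R. *)
Ltac mx_module :=
  repeat match goal with
  | |- context [@mulmx ?R ?m ?n ?p ?M ?N] =>
    let x := fresh "prod" in set x := (@mulmx R m n p M N); clearbody x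
  end;
  let i := fresh "i" in let j := fresh "j" in
  apply/matrixP => i j; rewrite !mxE; ring.

(** * Positive semidefinite matrices and the trace pairing *)

Section Psd.
Variable R : realType.

Definition qf (n : nat) (M : 'M[R]_n) (v : 'cV[R]_n) : R := (v^T *m M *m v) 0 0.

Lemma qfD n (M N : 'M[R]_n) v : qf (M + N) v = qf M v + qf N v.
Proof. by rewrite /qf mulmxDr mulmxDl mxE. Qed.

Lemma qfN n (M : 'M[R]_n) v : qf (- M) v = - qf M v.
Proof. by rewrite /qf mulmxN mulNmx mxE. Qed.

Lemma qfZ n a (M : 'M[R]_n) v : qf (a *: M) v = a * qf M v.
Proof. by rewrite /qf -scalemxAr -scalemxAl mxE. Qed.

Lemma qf_congr n k (N : 'M[R]_(n, k)) (M : 'M[R]_n) v :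
  qf (N^T *m M *m N) v = qf M (N *m v).
Proof. by rewrite /qf trmx_mul !mulmxA. Qed.

Lemma qf_line n (M : 'M[R]_n) v w t : Defs.symmetric M ->
  qf M (v + t *: w) = qf M v + 2 * t * (v^T *m M *m w) 0 0 + t ^+ 2 * qf M w.
Proof.
rewrite /qf => sM; have -> : (v + t *: w)^T = v^T + t *: w^T :> 'rV_n.
  by apply/rowP => i; rewrite !mxE.
have e1 : (w^T *m M *m v) 0 0 = (v^T *m M *m w) 0 0.
  have <- : (v^T *m M *m w)^T = w^T *m M *m v by rewrite !trmx_mul trmxK sM mulmxA.
  by rewrite mxE.
rewrite !mulmxDl !mulmxDr -!scalemxAl -!scalemxAr.
have e : forall x y z u : 'M[R]_1, (x + t *: y + (t *: z + t *: (t *: u))) 0 0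
   = x 0 0 + t * y 0 0 + (t * z 0 0 + t * (t * u 0 0)) by move=> *; rewrite !mxE.
rewrite e e1; ring.
Qed.

Lemma qf1 n (v : 'cV[R]_n) : qf 1%:M v = \sum_i v i 0 ^+ 2.
Proof. by rewrite /qf mulmx1 mxE; apply: eq_bigr => i _; rewrite mxE expr2. Qed.

Lemma qf1_ge0 n (v : 'cV[R]_n) : 0 <= qf 1%:M v.
Proof. by rewrite qf1; apply: sumr_ge0 => i _; apply: sqr_ge0. Qed.

Lemma qf1_eq0 n (v : 'cV[R]_n) : qf 1%:M v = 0 -> v = 0.
Proof.
rewrite qf1 => /eqP; rewrite psumr_eq0; last by move=> i _; apply: sqr_ge0.
move=> /allP h; apply/colP => i; rewrite mxE.
by have := h i (mem_index_enum _); rewrite sqrf_eq0 => /eqP.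
Qed.

Lemma qf1_gt0 n (v : 'cV[R]_n) : v != 0 -> 0 < qf 1%:M v.
Proof.
move=> v0; rewrite lt_def qf1_ge0 andbT; apply: contra v0 => /eqP /qf1_eq0 ->.
by rewrite eqxx.
Qed.

Lemma psd0 n : psd (0 : 'M[R]_n).
Proof. by split=> [|v]; [rewrite /Defs.symmetric trmx0 | rewrite mulmx0 mul0mx mxE]. Qed.

Lemma psdD n (M N : 'M[R]_n) : psd M -> psd N -> psd (M + N).
Proof.
move=> [sM hM] [sN hN]; split=> [|v]; first by rewrite /Defs.symmetric linearD /= sM sN.
by have := addr_ge0 (hM v) (hN v); rewrite -/(qf M v) -/(qf N v) -qfD.
Qed.

Lemma psdZ n a (M : 'M[R]_n) : 0 <= a -> psd M -> psd (a *: M).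
Proof.
move=> a0 [sM hM]; split=> [|v]; first by rewrite /Defs.symmetric linearZ /= sM.
by have := mulr_ge0 a0 (hM v); rewrite -/(qf M v) -qfZ.
Qed.

Lemma psd_congr n k (N : 'M[R]_(n, k)) (M : 'M[R]_n) :
  psd M -> psd (N^T *m M *m N).
Proof.
move=> [sM hM]; split=> [|v]; last by rewrite -/(qf _ v) qf_congr; exact: hM.
by rewrite /Defs.symmetric !trmx_mul trmxK sM mulmxA.
Qed.

Lemma psd_sum n (I : Type) (s : seq I) (F : I -> 'M[R]_n) :
  (forall i, psd (F i)) -> psd (\sum_(i <- s) F i).
Proof. by move=> h; elim/big_ind: _ => //; [exact: psd0 | exact: psdD]. Qed.

Lemma pd_psd n (M : 'M[R]_n) : pd M -> psd M.
Proof.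
move=> [sM hM]; split=> // v; have [->|/hM /ltW //] := eqVneq v 0.
by rewrite mulmx0 mxE.
Qed.

Lemma pd1 n : pd (1%:M : 'M[R]_n).
Proof. by split=> [|v v0]; [rewrite /Defs.symmetric trmx1 | exact: qf1_gt0]. Qed.

Lemma psd_gram n k (C : 'M[R]_(k, n)) : psd (C^T *m C).
Proof. by rewrite -[C^T]mulmx1; apply/psd_congr/pd_psd/pd1. Qed.

Lemma pd_psdD n (M N : 'M[R]_n) : pd M -> psd N -> pd (M + N).
Proof.
move=> [sM hM] [sN hN]; split=> [|v v0]; first by rewrite /Defs.symmetric linearD /= sM sN.
by have := ltr_wpDr (hN v) (hM v v0); rewrite -/(qf M v) -/(qf N v) -qfD.
Qed.

Lemma pd_unitmx n (M : 'M[R]_n) : pd M -> M \in unitmx.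
Proof.
move=> [sM hM]; rewrite -row_free_unit -kermx_eq0; apply/eqP/row_matrixP => i.
rewrite row0; apply/eqP; apply: contraT => h.
have := hM (row i (kermx M))^T.
rewrite trmxK -row_mul mulmx_ker row0 mul0mx mxE ltxx.
by apply; rewrite -trmx0 (inj_eq (can_inj (@trmxK _ _ _))).
Qed.

(** Moving from [v] in the direction [w = M v] gives the form the value [2 t |w|^2 + t^2 b], which a
    small negative [t] makes negative unless [w = 0]. *)
Lemma psd_ker n (M : 'M[R]_n) v : psd M -> qf M v = 0 -> M *m v = 0.
Proof.
move=> [sM hM] h; set w := M *m v; apply: qf1_eq0.
set a := qf _ w; set b := qf M w.
have b0 : 0 <= b by exact: hM.
have a0 : 0 <= a by exact: qf1_ge0.
have key t : 0 <= 2 * t * a + t ^+ 2 * b.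
  have := hM (v + t *: w); rewrite -/(qf _ _) qf_line // h add0r.
  suff -> : (v^T *m M *m w) 0 0 = a by [].
  by rewrite /a /qf mulmx1 /w trmx_mul sM.
apply/eqP; rewrite eq_le a0 andbT leNgt; apply/negP => ap.
have bp : 0 < 1 + b by lra.
(* The denominator [1 + b] instead of [b] also covers the case [b = 0]. *)
have := key (- a / (1 + b)).
rewrite leNgt => /negP; apply.
have -> : 2 * (- a / (1 + b)) * a + (- a / (1 + b)) ^+ 2 * b
  = - (a ^+ 2 * (2 + b) / (1 + b) ^+ 2) by field; lra.
by rewrite oppr_lt0 divr_gt0 ?mulr_gt0 ?exprn_gt0 //; lra.
Qed.

Lemma mulmx_col_eq0 n k (M N : 'M[R]_(n, k)) : (forall v : 'cV_k, M *m v = N *m v) -> M = N.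
Proof.
move=> h; apply/matrixP => i j; have /colP/(_ i) := h (delta_mx j 0).
by rewrite -!colE !mxE.
Qed.

Lemma psd_anti n (M : 'M[R]_n) : psd M -> psd (- M) -> M = 0.
Proof.
move=> pM pN; apply: mulmx_col_eq0 => v; rewrite mul0mx; apply: psd_ker => //.
apply/eqP; rewrite eq_le; have := pN.2 v; rewrite -/(qf _ v) qfN oppr_ge0 => ->.
exact: pM.2.
Qed.

Lemma loewner_anti n (X Y : 'M[R]_n) : loewner_le X Y -> loewner_le Y X -> X = Y.
Proof.
rewrite /loewner_le -[X - Y]opprB => h1 h2.
by apply/esym/eqP; rewrite -subr_eq0; apply/eqP/psd_anti.
Qed.

Lemma mx_dim0 n (M N : 'M[R]_n) : n = 0%N -> M = N.
Proof. by move=> n0; apply/matrixP => i; have := ltn_ord i; rewrite {2}n0. Qed.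

Lemma qf_delta n (M : 'M[R]_n) i : qf M (delta_mx i 0) = M i i.
Proof. by rewrite /qf -mulmxA -colE trmx_delta -rowE !mxE. Qed.

Lemma psd_diag_ge0 n (M : 'M[R]_n) i : psd M -> 0 <= M i i.
Proof. by move=> [_ h]; rewrite -qf_delta; exact: h. Qed.

Lemma psd_diag0 n (M : 'M[R]_n) i j : psd M -> M i i = 0 -> M j i = 0.
Proof.
move=> pM; rewrite -qf_delta => /(psd_ker pM); rewrite -colE => /colP/(_ j).
by rewrite !mxE.
Qed.

(** The form at [e_i + e_j] and [e_i - e_j] gives [2 |M i j| <= M i i + M j j]. This is what makes a
    set of psd matrices of bounded trace bounded. *)
Lemma psd_entry_le n (M : 'M[R]_n) i j : psd M -> `|M i j| <= \tr M.
Proof.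
move=> pM; have [sM hM] := pM.
have sE : M j i = M i j by move/matrixP/(_ i j): sM; rewrite mxE.
have dle k : M k k <= \tr M.
  by rewrite /mxtrace (bigD1 k) //= lerDl sumr_ge0 // => l _; exact: psd_diag_ge0.
have ex (s : R) : qf M (delta_mx i 0 + s *: delta_mx j 0)
   = M i i + s * (2 * M i j) + s ^+ 2 * M j j.
  rewrite qf_line // !qf_delta trmx_delta -rowE -colE !mxE; ring.
have h1 := hM (delta_mx i 0 + 1 *: delta_mx j 0).
have h2 := hM (delta_mx i 0 + (-1) *: delta_mx j 0).
rewrite -/(qf _ _) ex in h1; rewrite -/(qf _ _) ex in h2.
have di := dle i; have dj := dle j.
rewrite ler_norml; apply/andP; split; nra.
Qed.

Lemma psd_tr_ge0 n (M : 'M[R]_n) : psd M -> 0 <= \tr M.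
Proof. by move=> pM; apply: sumr_ge0 => i _; exact: psd_diag_ge0. Qed.

Lemma psd_tr_eq0 n (M : 'M[R]_n) : psd M -> \tr M = 0 -> M = 0.
Proof.
move=> pM h; apply/matrixP => i j; have := psd_entry_le i j pM.
by rewrite h normr_le0 mxE => /eqP.
Qed.

(* Cholesky without pivots: the Schur complement at a nonzero diagonal entry
   kills that entry and preserves the zero ones. *)
Lemma psd_factor n (S : 'M[R]_n) : psd S ->
  exists (k : nat) (W : 'M[R]_(k, n)), S = W^T *m W.
Proof.
have [l] := ubnP #|[pred i | S i i != 0]|; elim: l S => // l IH S lt pS.
have [/forallP h0|] := boolP [forall i, S i i == 0].
  exists 0%N, 0; rewrite mulmx0; apply: psd_tr_eq0 => //.
  by apply: big1 => i _; apply/eqP/h0.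
rewrite negb_forall => /existsP [i di].
have dp : 0 < S i i by rewrite lt_def di psd_diag_ge0.
pose u := row i S; pose S' := S - (S i i)^-1 *: (u^T *m u).
have [sS hS] := pS.
have colu : col i S = u^T by rewrite /u tr_row sS.
have pS' : psd S'.
  split=> [|v].
    by rewrite /Defs.symmetric linearB /= linearZ /= trmx_mul trmxK sS.
  (* This [t] minimises the form of [S] at [v - t e_i], and the minimum is the form of [S'] at
     [v]. *)
  pose t := (u *m v) 0 0 / S i i.
  have := hS (v + (- t) *: delta_mx i 0).
  rewrite -!/(qf _ _) qf_line // qf_delta.
  have -> : (v^T *m S *m (delta_mx i 0 : 'cV_n)) 0 0 = (u *m v) 0 0.
    by rewrite -mulmxA -colE colu -trmx_mul mxE.
  rewrite /S' qfD qfN qfZ -[u^T]mulmx1 qf_congr qf1 big_ord1.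
  move=> h; suff -> : (S i i)^-1 * (u *m v) 0 0 ^+ 2
     = 2 * t * (u *m v) 0 0 - t ^+ 2 * S i i by lra.
  by rewrite /t; field; rewrite gt_eqF.
have S'E j : S' j j = S j j - (S i i)^-1 * S i j ^+ 2.
  by rewrite !mxE big_ord1 !mxE expr2.
have [] := IH S' _ pS'.
  rewrite ltnS in lt; apply: leq_trans lt; apply: proper_card.
  apply/properP; split.
    apply/fintype.subsetP => j; rewrite !inE; apply: contra => /eqP Sj.
    by rewrite S'E Sj (psd_diag0 i pS Sj) expr0n mulr0 subr0.
  by exists i; rewrite inE // S'E negbK; apply/eqP; field; exact: di.
move=> k [W hW]; exists (k + 1)%N, (col_mx W ((Num.sqrt (S i i))^-1 *: u)).
rewrite tr_col_mx mul_row_col -hW [(_ *: u)^T]linearZ /= -scalemxAl -scalemxAr scalerA.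
by rewrite -invfM -expr2 sqr_sqrtr ?ltW // /S' subrK.
Qed.

(** With [S = W^T W] this is the trace of the psd matrix [W X W^T]. *)
Lemma tr_psd_mul n (X S : 'M[R]_n) : psd X -> psd S -> 0 <= \tr (X *m S).
Proof.
move=> pX /psd_factor [k [W ->]]; rewrite mulmxA mxtrace_mulC mulmxA.
by apply: psd_tr_ge0; have := psd_congr W^T pX; rewrite trmxK.
Qed.

(** Here [W X W^T] is psd of trace zero, hence zero, so [X] kills the range of [W^T]. *)
Lemma tr_psd_mul_eq0 n (X S : 'M[R]_n) : psd X -> psd S ->
  \tr (X *m S) = 0 -> X *m S = 0.
Proof.
move=> pX /psd_factor [k [W ->]]; rewrite mulmxA mxtrace_mulC mulmxA => h.
have pW : psd (W *m X *m W^T) by have := psd_congr W^T pX; rewrite trmxK.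
suff -> : X *m W^T = 0 by rewrite mul0mx.
apply: mulmx_col_eq0 => v; rewrite mul0mx -mulmxA; apply: psd_ker => //.
rewrite -qf_congr trmxK (psd_tr_eq0 pW h) /qf; by rewrite mulmx0 mul0mx mxE.
Qed.

Lemma tr_pd_mul_eq0 n (X S : 'M[R]_n) : pd X -> psd S -> \tr (X *m S) = 0 -> S = 0.
Proof.
move=> pX pS /(tr_psd_mul_eq0 (pd_psd pX) pS) h.
by rewrite -[S](mulKmx (pd_unitmx pX)) h mulmx0.
Qed.

End Psd.

(** * Entrywise limits, compactness and extremal eigenvalues *)

Section MatrixLimits.
Variable R : realType.

Lemma cvg_bigsum T (F : set_system T) {FF : Filter F} (I : Type) (s : seq I)
  (f : I -> T -> R) (l : I -> R) :
  (forall i, f i x @[x --> F] --> l i) ->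
  \sum_(i <- s) f i x @[x --> F] --> \sum_(i <- s) l i.
Proof. by move=> h; apply: cvg_big => // x; exact: add_continuous. Qed.

Lemma cvg_bigprod T (F : set_system T) {FF : Filter F} (I : Type) (s : seq I)
  (f : I -> T -> R) (l : I -> R) :
  (forall i, f i x @[x --> F] --> l i) ->
  \prod_(i <- s) f i x @[x --> F] --> \prod_(i <- s) l i.
Proof. by move=> h; apply: cvg_big => // x; exact: mul_continuous. Qed.

(** The filter is arbitrary so that the same closure rules serve for sequences ([\oo]) and for
    continuity at a point ([nbhs M]). *)
Definition mxcvg T (F : set_system T) p q (f : T -> 'M[R]_(p, q)) (M : 'M[R]_(p, q)) :=
  forall i j, f x i j @[x --> F] --> M i j.

Section Filter.
Variables (T : Type) (F : set_system T).
Context {FF : Filter F}.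

Lemma mxcvg_cst p q (M : 'M[R]_(p, q)) : mxcvg F (fun=> M) M.
Proof. by move=> i j; exact: cvg_cst. Qed.

Lemma mxcvgD p q (f g : T -> 'M[R]_(p, q)) M N :
  mxcvg F f M -> mxcvg F g N -> mxcvg F (fun x => f x + g x) (M + N).
Proof.
move=> hf hg i j; under eq_cvg do rewrite mxE.
by rewrite mxE; apply: cvgD.
Qed.

Lemma mxcvgN p q (f : T -> 'M[R]_(p, q)) M :
  mxcvg F f M -> mxcvg F (fun x => - f x) (- M).
Proof.
move=> hf i j; under eq_cvg do rewrite mxE.
by rewrite mxE; apply: cvgN.
Qed.

Lemma mxcvgZ p q (a : T -> R) (b : R) (f : T -> 'M[R]_(p, q)) M :
  a x @[x --> F] --> b -> mxcvg F f M -> mxcvg F (fun x => a x *: f x) (b *: M).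
Proof.
move=> ha hf i j; under eq_cvg do rewrite mxE.
by rewrite mxE; apply: cvgM.
Qed.

Lemma mxcvgM p q r (f : T -> 'M[R]_(p, q)) (g : T -> 'M[R]_(q, r)) M N :
  mxcvg F f M -> mxcvg F g N -> mxcvg F (fun x => f x *m g x) (M *m N).
Proof.
move=> hf hg i j; under eq_cvg do rewrite mxE.
by rewrite mxE; apply: cvg_bigsum => k; apply: cvgM.
Qed.

Lemma mxcvgT p q (f : T -> 'M[R]_(p, q)) M :
  mxcvg F f M -> mxcvg F (fun x => (f x)^T) M^T.
Proof.
move=> hf i j; under eq_cvg do rewrite mxE.
by rewrite mxE; apply: hf.
Qed.

Lemma mxcvg_sum (I : Type) (s : seq I) p q (f : I -> T -> 'M[R]_(p, q)) M :
  (forall i, mxcvg F (f i) (M i)) ->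
  mxcvg F (fun x => \sum_(i <- s) f i x) (\sum_(i <- s) M i).
Proof.
move=> h i j; under eq_cvg do rewrite summxE.
by rewrite summxE; apply: cvg_bigsum => k; apply: h.
Qed.

Lemma cvg_det n (f : T -> 'M[R]_n) M :
  mxcvg F f M -> \det (f x) @[x --> F] --> \det M.
Proof.
move=> h; apply: cvg_bigsum => s; apply: cvgM; first exact: cvg_cst.
by apply: cvg_bigprod => i; apply: h.
Qed.

(** By Cramer's formula; invertibility at every [x] makes that formula an equality of functions,
    since [invmx] returns a singular matrix unchanged. *)
Lemma mxcvg_inv n (f : T -> 'M[R]_n) M :
  (forall x, f x \in unitmx) -> M \in unitmx ->
  mxcvg F f M -> mxcvg F (fun x => invmx (f x)) (invmx M).
Proof.
move=> uf uM h.
have -> : (fun x => invmx (f x)) = fun x => (\det (f x))^-1 *: \adj (f x).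
  by apply/funext => x; rewrite /invmx uf.
rewrite /invmx uM; apply: mxcvgZ.
  apply: cvgV; last exact: cvg_det.
  by move: uM; rewrite unitmxE unitfE.
move=> i j; under eq_cvg do rewrite mxE.
rewrite mxE; apply: cvgM; first exact: cvg_cst.
apply: cvg_det => k l; under eq_cvg do rewrite !mxE.
by rewrite !mxE; apply: h.
Qed.

Lemma cvg_tr n (f : T -> 'M[R]_n) M :
  mxcvg F f M -> \tr (f x) @[x --> F] --> \tr M.
Proof. by move=> h; apply: cvg_bigsum => i; apply: h. Qed.

Lemma cvg_qf n (f : T -> 'M[R]_n) M (g : T -> 'cV[R]_n) v :
  mxcvg F f M -> mxcvg F g v -> qf (f x) (g x) @[x --> F] --> qf M v.
Proof. by move=> hf hg; apply: mxcvgM => //; apply: mxcvgM => //; apply: mxcvgT. Qed.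

Lemma cvg_mxnorm1 p q (f : T -> 'M[R]_(p, q)) M :
  mxcvg F f M -> mxnorm1 (f x) @[x --> F] --> mxnorm1 M.
Proof.
move=> h; apply: cvg_bigsum => i; apply: cvg_bigsum => j.
by apply: cvg_norm; apply: h.
Qed.

Lemma mxcvg_to p q (f : T -> 'M[R]_(p, q)) (M : 'M[R]_(p, q)) :
  mxcvg F f M -> f x @[x --> F] --> M.
Proof.
move=> h A [P MP sPA].
have : \forall x \near F, forall i, forall j, P i j (f x i j).
  by apply: filter_forall => i; apply: filter_forall => j; apply: h; apply: MP.
by apply: filterS => x hx; apply: sPA.
Qed.

End Filter.

Lemma mxcvg_unique p q (f : nat -> 'M[R]_(p, q)) (M N : 'M[R]_(p, q)) :
  mxcvg \oo f M -> mxcvg \oo f N -> M = N.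
Proof.
by move=> hM hN; apply/matrixP => i j; apply: (cvg_unique _ (hM i j) (hN i j)); exact: Rhausdorff.
Qed.

Lemma mxcvg_id p q (M : 'M[R]_(p, q)) : mxcvg (nbhs M) id M.
Proof. by move=> i j; exact: coord_continuous. Qed.

Lemma mxnorm1_eq0 p q (M : 'M[R]_(p, q)) : mxnorm1 M = 0 -> M = 0.
Proof.
move=> /eqP; rewrite psumr_eq0 => [/allP h|i _]; last by apply: sumr_ge0.
apply/matrixP => i j; have := h i (mem_index_enum _); rewrite psumr_eq0 //=.
by move=> /allP /(_ j (mem_index_enum _)); rewrite normr_eq0 mxE => /eqP.
Qed.

(** [K] is a closed subset of the image of a compact box of row vectors under the continuous map
    [vec_mx]. *)
Lemma mx_compact p q (K : set 'M[R]_(p, q)) c :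
  closed K -> (forall M, K M -> forall i j, `|M i j| <= c) -> compact K.
Proof.
move=> cK bK.
pose box := [set v : 'rV[R]_(p * q) | forall k, `[- c, c]%classic (v ord0 k)].
have cbox : compact box by apply: (@rV_compact R _ (fun=> `[- c, c]%classic)) => i; exact: segment_compact.
have cvec : continuous (@vec_mx R p q).
  move=> v; apply: (@mxcvg_to _ (nbhs v)) => i j; under eq_cvg do rewrite mxE.
  by rewrite mxE; exact: coord_continuous.
have cimg : compact (@vec_mx R p q @` box).
  by apply: continuous_compact => //; exact: continuous_subspaceT.
apply: subclosed_compact cK cimg _ => M KM.
exists (mxvec M); last exact: mxvecK.
move=> k; case/mxvec_indexP: k => i j; rewrite mxvecE /= in_itv /=.
by rewrite -ler_norml; apply: bK.
Qed.

Lemma closed_setge0 (T : topologicalType) (g : T -> R) :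
  continuous g -> closed [set x | 0 <= g x].
Proof.
by move=> cg; apply: (@preimage_closed _ _ g) (@closed_ge R 0) => x _; exact: cg.
Qed.

Lemma closed_psd n : closed [set M : 'M[R]_n | psd M].
Proof.
(* Symmetry is written as inequalities for both orders of [(i, j)], so that every condition has the
   closed form [0 <= g M]. *)
have -> : [set M : 'M[R]_n | psd M] =
  (\bigcap_(ij in [set: 'I_n * 'I_n]) [set M : 'M[R]_n | 0 <= M ij.1 ij.2 - M ij.2 ij.1])
  `&` \bigcap_(v in [set: 'cV[R]_n]) [set M : 'M[R]_n | 0 <= qf M v].
  apply/seteqP; split=> M.
    move=> [sM hM]; split=> [[i j] _ /=|v _]; last exact: hM.
    by rewrite -[in M j i]sM mxE subrr.
  move=> [h1 h2]; split=> [|v]; last exact: h2.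
  apply/matrixP => i j; rewrite mxE; apply/eqP; rewrite eq_le.
  by apply/andP; split; rewrite -subr_ge0; [exact: (h1 (i, j)) | exact: (h1 (j, i))].
apply: closedI; apply: closed_bigI => x _; apply: closed_setge0 => M.
  by apply: (@cvgB _ R^o _ (nbhs M)); exact: mxcvg_id.
by apply: (@cvg_qf _ (nbhs M)); [exact: mxcvg_id | exact: mxcvg_cst].
Qed.

(* [rho] is the least generalized eigenvalue of the pencil (S, P), the minimum
   of the Rayleigh quotient qf S / qf P on the unit sphere. *)
Lemma pencil_min n (S P : 'M[R]_n) : (0 < n)%N -> Defs.symmetric S -> pd P ->
  exists rho : R, exists2 v : 'cV[R]_n, v != 0 & psd (S - rho *: P) /\ (S - rho *: P) *m v = 0.
Proof.
move=> n0 sS pP.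
pose K := [set v : 'cV[R]_n | qf 1%:M v = 1].
have cqf (M : 'M[R]_n) : continuous (qf M).
  by move=> v; apply: (@cvg_qf _ (nbhs v)); [exact: mxcvg_cst | exact: mxcvg_id].
have Kn0 v : K v -> v != 0.
  by move=> Kv; apply/eqP => v0; move: Kv; rewrite /K /= v0 /qf mulmx0 mxE => /eqP; rewrite eq_sym oner_eq0.
have clK : closed K by apply: (@preimage_closed _ _ (qf 1%:M)) (@closed_eq R 1) => x _; exact: cqf.
have cK : compact K.
  apply: (mx_compact (c := 1)) => // v Kv i j; rewrite ord1.
  rewrite -(@expr_le1 _ 2) // real_normK ?num_real // -Kv qf1 (bigD1 i) //= lerDl.
  by apply: sumr_ge0 => k _; exact: sqr_ge0.
have scale v (c : R) (M : 'M[R]_n) : qf M (c *: v) = c ^+ 2 * qf M v.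
  by rewrite /qf [(_ *: _)^T]linearZ /= -!scalemxAl -scalemxAr scalerA mxE expr2.
have norm1 v : v != 0 -> K ((Num.sqrt (qf 1%:M v))^-1 *: v).
  move=> v0; have p := qf1_gt0 v0.
  by rewrite /K /= scale exprVn sqr_sqrtr ?ltW // mulVf // gt_eqF.
have K0 : K !=set0.
  exists (delta_mx (Ordinal n0) 0); rewrite /K /= qf_delta mxE eqxx //.
have cf : {within K, continuous (fun v => qf S v / qf P v)}.
  apply: continuous_in_subspaceT => v /set_mem /Kn0 v0.
  by apply: (@cvgM _ _ (nbhs v)); [exact: cqf | apply: (@cvgV _ _ (nbhs v)); [rewrite gt_eqF //; exact: pP.2 | exact: cqf]].
have [v /set_mem Kv vmin] := compact_EVT_min K0 cK cf.
have v0 := Kn0 _ Kv; have Pv := pP.2 _ v0.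
exists (qf S v / qf P v), v => //.
have pS : psd (S - (qf S v / qf P v) *: P).
  split=> [|w]; first by rewrite /Defs.symmetric linearB /= linearZ /= sS pP.1.
  have [->|w0] := eqVneq w 0; first by rewrite mulmx0 mxE.
  (* The quotient is invariant under scaling, so minimality on the unit sphere extends to every
     nonzero [w]. *)
  have := vmin _ (mem_set (norm1 _ w0)).
  rewrite !scale -!/(qf _ _) qfD qfN qfZ.
  have p := qf1_gt0 w0; have Pw : 0 < qf P w := pP.2 _ w0.
  rewrite -mulf_div divff ?mul1r; last by rewrite expf_neq0 // invr_neq0 // sqrtr_eq0 -ltNge.
  by rewrite ler_pdivlMr // subr_ge0.
split=> //; apply: psd_ker => //.
by rewrite qfD qfN qfZ divfK ?subrr // gt_eqF.
Qed.

(** The margin is the least eigenvalue of [P], positive because [P] is positive at its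
    eigenvector. *)
Lemma pd_lower n (P : 'M[R]_n) : pd P -> exists2 d, 0 < d & psd (P - d *: 1%:M).
Proof.
case: n P => [|n] P pP.
  by exists 1 => //; rewrite [_ - _]thinmx0; exact: psd0.
have [rho [v v0 [pR kR]]] := pencil_min (ltn0Sn n) pP.1 (pd1 R _).
exists rho => //.
have h : qf (P - rho *: 1%:M) v = 0 by rewrite /qf -mulmxA kR mulmx0 mxE.
move: h; rewrite qfD qfN qfZ => /eqP; rewrite subr_eq0 => /eqP h.
by rewrite -(pmulr_lgt0 _ (qf1_gt0 v0)) -h; exact: pP.2.
Qed.

Lemma pd_upper n (M : 'M[R]_n) : Defs.symmetric M -> exists2 c, 0 < c & pd (c *: 1%:M - M).
Proof.
move=> sM; have [n0|n0] := posnP n.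
  by exists 1 => //; rewrite (mx_dim0 (_ - M) 1%:M n0); exact: pd1.
have sN : Defs.symmetric (- M) by rewrite /Defs.symmetric raddfN /= sM.
have [rho [v v0 [pT Tv]]] := pencil_min n0 sN (pd1 R n).
(* [rho] is the least eigenvalue of [- M]; the added 1 makes the bound strict. *)
exists (`|rho| + 1); first by rewrite ltr_wpDl.
have -> : (`|rho| + 1) *: 1%:M - M = 1%:M + ((- M - rho *: 1%:M) + (`|rho| + rho) *: 1%:M).
  by mx_module.
apply: pd_psdD; first exact: pd1.
apply: psdD => //; apply: psdZ; last exact/pd_psd/pd1.
by have := ler_norm (- rho); rewrite normrN; lra.
Qed.

(** Each form [qf (X k) v] is nondecreasing and bounded by [qf Xs v]. Polarisation at [e_i], [e_j]
    and [e_i + e_j] carries convergence over to the entries, and closedness of the psd cone carries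
    the bounds to the limit. *)
Lemma monotone_limit n (X : nat -> 'M[R]_n) (Xs : 'M[R]_n) :
  (forall k, psd (X k)) -> (forall k, loewner_le (X k) (X k.+1)) ->
  (forall k, loewner_le (X k) Xs) ->
  exists Xo, [/\ mxcvg \oo X Xo, psd Xo & loewner_le Xo Xs].
Proof.
move=> pX mX bX.
have cq v : cvgn (fun k => qf (X k) v).
  apply: nondecreasing_is_cvgn.
    apply/nondecreasing_seqP => k; rewrite -subr_ge0 -qfN -qfD; exact: (mX k).2.
  exists (qf Xs v) => _ [k _ <-]; rewrite -subr_ge0 -qfN -qfD; exact: (bX k).2.
have polar k i j : X k i j = 2^-1 * (qf (X k) (delta_mx i 0 + 1 *: delta_mx j 0)
    - qf (X k) (delta_mx i 0) - qf (X k) (delta_mx j 0)).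
  by rewrite (qf_line _ _ _ (pX k).1) !qf_delta trmx_delta -rowE -colE !mxE; field.
pose Xo : 'M[R]_n := \matrix_(i, j) limn (fun k => X k i j).
have cX : mxcvg \oo X Xo.
  move=> i j; rewrite mxE.
  have -> : (fun k => X k i j) = fun k => 2^-1 * (qf (X k) (delta_mx i 0 + 1 *: delta_mx j 0)
      - qf (X k) (delta_mx i 0) - qf (X k) (delta_mx j 0)) by apply/funext => k; exact: polar.
  have h : cvgn (fun k => 2^-1 * (qf (X k) (delta_mx i 0 + 1 *: delta_mx j 0)
      - qf (X k) (delta_mx i 0) - qf (X k) (delta_mx j 0))).
    apply: is_cvgM; first exact: is_cvg_cst.
    by apply: (@is_cvgB _ R^o) => //; apply: (@is_cvgB _ R^o).
  exact: h.
exists Xo; split=> //.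
  apply: (@closed_cvg _ _ \oo _ X (@psd R n) (@closed_psd n)); last exact: mxcvg_to.
  by apply: nearW => k; exact: pX.
apply: (@closed_cvg _ _ \oo _ (fun k => Xs - X k) (@psd R n) (@closed_psd n)).
  by apply: nearW => k; exact: bX.
apply: mxcvg_to; apply: mxcvgD; [exact: mxcvg_cst | exact: mxcvgN].
Qed.

End MatrixLimits.

(** * Generalised Lyapunov operators and their Perron theorem *)

Section Lyapunov.
Variable R : realType.

Lemma linear_inj_surj p q (f : {linear 'M[R]_(p, q) -> 'M[R]_(p, q)}) :
  (forall S, f S = 0 -> S = 0) -> forall Y, exists S, f S = Y.
Proof.
move=> inj Y; have u : lin_mx f \in unitmx.
  rewrite -row_free_unit -kermx_eq0; apply/eqP/row_matrixP => i.
  rewrite row0 -[row i _]vec_mxK; suff -> : vec_mx (row i (kermx (lin_mx f))) = 0.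
    by rewrite linear0.
  apply: inj; apply: (can_inj mxvecK).
  by rewrite -mul_rV_lin -row_mul mulmx_ker row0 linear0.
exists (vec_mx (mxvec Y *m invmx (lin_mx f))); apply: (can_inj mxvecK).
by rewrite -mul_rV_lin mulmxKV.
Qed.

(** This form acts on cost matrices; the second-moment operator [A S + S A^T + sum N S N^T] is its
    dual for the trace pairing, obtained by transposing all coefficients. *)
Definition lyap r n (A : 'M[R]_n) (N : 'I_r -> 'M[R]_n) (S : 'M[R]_n) : 'M[R]_n :=
  A^T *m S + S *m A + \sum_i (N i)^T *m S *m N i.

(* [P] certifies that S' = lyap A N S grows slower than exp (mu t), so that
   [decay A N 0] is mean-square stability. *)
Definition decay r n (A : 'M[R]_n) (N : 'I_r -> 'M[R]_n) (mu : R) :=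
  exists2 P, pd P & pd (mu *: P - lyap A N P).

Section Fixed.
Variables (r n : nat) (A : 'M[R]_n) (N : 'I_r -> 'M[R]_n).

Lemma lyap_is_linear : linear (lyap A N).
Proof.
move=> a S T; rewrite /lyap !mulmxDr !mulmxDl.
rewrite -!scalemxAr -!scalemxAl.
have -> : \sum_i (N i)^T *m (a *: S + T) *m N i =
    a *: (\sum_i (N i)^T *m S *m N i) + \sum_i (N i)^T *m T *m N i.
  by rewrite scaler_sumr -big_split; apply: eq_bigr => i _; rewrite mulmxDr mulmxDl -scalemxAr -scalemxAl.
move: (\sum_i _) (\sum_i _) => U V; mx_module.
Qed.
HB.instance Definition _ := GRing.isLinear.Build R 'M[R]_n 'M[R]_n _ (lyap A N) lyap_is_linear.

Lemma lyap_sym S : Defs.symmetric S -> Defs.symmetric (lyap A N S).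
Proof.
move=> sS; rewrite /Defs.symmetric /lyap !raddfD /= raddf_sum /= !trmx_mul trmxK sS.
congr (_ + _); first by rewrite addrC.
by apply: eq_bigr => i _; rewrite !trmx_mul trmxK sS mulmxA.
Qed.

(** On the kernel of [T] the drift terms vanish and only the psd noise term remains. All comparison
    results below rest on this positivity. *)
Lemma qf_lyap_ge0 T v : psd T -> T *m v = 0 -> 0 <= qf (lyap A N T) v.
Proof.
move=> pT h; have h' : v^T *m T = 0 by rewrite -(trmxK T) -trmx_mul pT.1 h trmx0.
have pS : psd (\sum_i (N i)^T *m T *m N i) by apply: psd_sum => i; exact: psd_congr.
rewrite /lyap qfD addr_ge0 //; last exact: pS.2.
by rewrite /qf mulmxDr mulmxDl [_ *m (T *m A)]mulmxA h' -!mulmxA h !(mulmx0, mul0mx) addr0 mxE.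
Qed.

(** A minimum principle. If the least generalized eigenvalue [rho] of [(S, P)] were negative, then
    [S - rho P] would be psd with a kernel vector at which its image under [lyap] is negative. *)
Lemma decay_psd mu S : decay A N mu -> Defs.symmetric S ->
  psd (mu *: S - lyap A N S) -> psd S.
Proof.
move=> [P pP pD] sS pS.
have [n0|n0] := posnP n; first by rewrite (mx_dim0 S 0 n0); exact: psd0.
have [rho [v v0 [pT Tv]]] := pencil_min n0 sS pP.
have [r0|r0] := leP 0 rho.
  by rewrite -(subrK (rho *: P) S); apply: psdD => //; exact/psdZ/pd_psd.
have := qf_lyap_ge0 pT Tv; rewrite leNgt => /negP; case.
have e : qf (S - rho *: P) v = 0 by rewrite /qf -mulmxA Tv mulmx0 mxE.
have -> : lyap A N (S - rho *: P) = - (mu *: S - lyap A N S)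
   + (rho *: (mu *: P - lyap A N P) + mu *: (S - rho *: P)).
  by rewrite linearB linearZ /=; mx_module.
rewrite qfD qfD qfN !qfZ e mulr0 addr0.
have h1 : 0 <= qf (mu *: S - lyap A N S) v := pS.2 v.
have h2 : 0 < qf (mu *: P - lyap A N P) v := pD.2 v v0.
nra.
Qed.

Lemma decay_resolvent mu : decay A N mu ->
  exists2 S, psd S & mu *: S - lyap A N S = 1%:M.
Proof.
move=> dmu.
(* Uniqueness is known for symmetric matrices only, while [linear_inj_surj] needs an operator on all
   matrices. So [f] applies [mu - lyap] to the symmetric part and adds the antisymmetric part
   unchanged. *)
pose f (S : 'M[R]_n) := (mu *: (S + S^T) - lyap A N (S + S^T)) + (S - S^T).
have lf : linear f.
  move=> a S T; rewrite /f.
  have -> : a *: S + T + (a *: S + T)^T = a *: (S + S^T) + (T + T^T) by mx_module.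
  by rewrite lyap_is_linear; move: (lyap A N _) (lyap A N _) => U V; mx_module.
pose F := GRing.isLinear.Build R 'M[R]_n 'M[R]_n _ f lf.
pose g : {linear 'M[R]_n -> 'M[R]_n} := HB.pack f F.
have fT (S : 'M[R]_n) : f S + (f S)^T = 2 *: (mu *: (S + S^T) - lyap A N (S + S^T)).
  have sS : Defs.symmetric (S + S^T) by rewrite /Defs.symmetric raddfD /= trmxK addrC.
  rewrite /f; set T := S + S^T; have lT := lyap_sym sS; rewrite -/T in sS lT *.
  have -> : (mu *: T - lyap A N T + (S - S^T))^T = mu *: T^T - (lyap A N T)^T + (S^T - S).
    by mx_module.
  by rewrite lT sS; mx_module.
have sym (S : 'M[R]_n) : Defs.symmetric (S + S^T) by rewrite /Defs.symmetric raddfD /= trmxK addrC.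
have injg (S : 'M[R]_n) : g S = 0 -> S = 0.
  move=> gS; have := fT S; rewrite -[f S]/(g S) gS trmx0 addr0 => /esym /eqP.
  rewrite scaler_eq0 (negbTE (lt0r_neq0 _)) //= => /eqP h.
  have T0 : S + S^T = 0 :> 'M[R]_n.
    apply: psd_anti; first by apply: (decay_psd dmu (sym S)); rewrite h; exact: psd0.
    apply: (decay_psd dmu); first by rewrite /Defs.symmetric raddfN /= sym.
    by rewrite !linearN -opprD h oppr0; exact: psd0.
  have : f S = 0 by [].
  rewrite /f T0 !linear0 !add0r => /eqP.
  rewrite subr_eq0 => /eqP e; move: T0; rewrite -e -mulr2n => /eqP.
  by rewrite -scaler_nat scaler_eq0 pnatr_eq0 /= => /eqP.
have [S gS] := linear_inj_surj injg (1%:M).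
have h : mu *: (S + S^T) - lyap A N (S + S^T) = 1%:M.
  apply: (@scalerI _ _ 2); first by rewrite pnatr_eq0.
  by rewrite -fT -[f S]/(g S) gS trmx1 -mulr2n scaler_nat.
exists (S + S^T) => //; apply: (decay_psd dmu (sym S)).
by rewrite h; exact/pd_psd/pd1.
Qed.

Lemma decay_mono mu nu : mu <= nu -> decay A N mu -> decay A N nu.
Proof.
move=> le [P pP pD]; exists P => //.
have -> : nu *: P - lyap A N P = (mu *: P - lyap A N P) + (nu - mu) *: P by mx_module.
by apply: pd_psdD => //; apply: psdZ; [rewrite subr_ge0 | exact: pd_psd].
Qed.

(** The same [P] still works: [mu P - lyap P] has a margin [d], and [P] is strictly below [c], so
    [mu] can drop by [d / c]. *)
Lemma decay_open mu : decay A N mu -> exists2 nu, nu < mu & decay A N nu.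
Proof.
move=> [P pP pD].
have [d d0 hd] := pd_lower pD; have [c c0 hc] := pd_upper pP.1.
exists (mu - d / c); first by rewrite ltrBlDr ltrDl divr_gt0.
exists P => //.
have -> : (mu - d / c) *: P - lyap A N P =
   (d / c) *: (c *: 1%:M - P) + (mu *: P - lyap A N P - d *: 1%:M).
  rewrite scalerBr scalerA divfK ?gt_eqF //; mx_module.
apply: pd_psdD => //.
have [sQ hQ] := hc; split=> [|v v0]; first by rewrite /Defs.symmetric linearZ /= sQ.
by rewrite -/(qf _ v) qfZ mulr_gt0 ?divr_gt0 //; exact: hQ.
Qed.

Lemma decay_large : exists2 mu, 0 <= mu & decay A N mu.
Proof.
have [c c0 hc] := pd_upper (lyap_sym (trmx1 R n)).
by exists c; [exact: ltW | exists 1%:M; [exact: pd1|]].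
Qed.

(* At the infimum mus of the admissible shifts the normalised resolvents
   S / (1 + tr S), with mu S - lyap S = 1, accumulate (by compactness) at some
   T0 with lyap T0 - mus T0 = - tau 1 and tau = 1 - tr T0.  If tau > 0 then T0
   certifies decay at mus, contradicting openness; so tau = 0. *)
Lemma perron : ~ decay A N 0 ->
  exists lam S, [/\ 0 <= lam, psd S, S <> 0 & lyap A N S = lam *: S].
Proof.
move=> nd0.
pose Lam := [set mu | 0 <= mu /\ decay A N mu].
have Lam0 : Lam !=set0 by have [mu h1 h2] := decay_large; exists mu.
have lbL : has_lbound Lam by exists 0 => mu [].
have infL : has_inf Lam by [].
pose mus := inf Lam.
have mus0 : 0 <= mus by apply: lb_le_inf => // mu [].
have ndm : ~ decay A N mus.
  move=> /decay_open [nu lt dnu].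
  have [n0|n0] := leP 0 nu; last by apply: nd0; apply: decay_mono dnu; exact: ltW.
  by have : mus <= nu by [apply: ge_inf]; rewrite leNgt lt.
(* [K] contains the normalised resolvents, and [g] below measures the residual of the limit
   equation. A minimiser of [g] on the compact [K] replaces a convergent subsequence. *)
pose K := [set T : 'M[R]_n | psd T] `&` [set T | 0 <= 1 - \tr T].
pose h (T : 'M[R]_n) := lyap A N T - mus *: T + (1 - \tr T) *: 1%:M.
pose g T := mxnorm1 (h T).
have ctr (T : 'M[R]_n) : 1 - \tr T0 @[T0 --> nbhs T] --> 1 - \tr T.
  by apply: (@cvgB _ R^o _ (nbhs T)); [exact: cvg_cst | apply: (@cvg_tr _ _ (nbhs T)); exact: mxcvg_id].
have clK : closed K.
  by apply: closedI; [exact: closed_psd | apply: closed_setge0 => T; exact: ctr].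
have cK : compact K.
  apply: (mx_compact (c := 1)) => // T [pT]; rewrite /= subr_ge0 => tT i j.
  exact: le_trans (psd_entry_le i j pT) tT.
have K0 : K !=set0 by exists 0; split; [exact: psd0 | rewrite /= mxtrace0 subr0].
have cg : continuous g.
  move=> T; apply: (@cvg_mxnorm1 _ _ (nbhs T)).
  have id : mxcvg (nbhs T) id T := @mxcvg_id _ _ _ T.
  apply: (@mxcvgD _ _ (nbhs T)); last first.
    by apply: (@mxcvgZ _ _ (nbhs T)); [exact: ctr | exact: mxcvg_cst].
  apply: (@mxcvgD _ _ (nbhs T)); last first.
    by apply: (@mxcvgN _ _ (nbhs T)); apply: (@mxcvgZ _ _ (nbhs T)) => //; exact: cvg_cst.
  apply: (@mxcvgD _ _ (nbhs T)).
    apply: (@mxcvgD _ _ (nbhs T)); apply: (@mxcvgM _ _ (nbhs T)) => //; exact: mxcvg_cst.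
  apply: (@mxcvg_sum _ _ (nbhs T)) => i; apply: (@mxcvgM _ _ (nbhs T)); last exact: mxcvg_cst.
  by apply: (@mxcvgM _ _ (nbhs T)) => //; exact: mxcvg_cst.
have [T0 /set_mem [pT0 tT0] Tmin] := compact_EVT_min K0 cK (continuous_subspaceT cg).
have hT0 : h T0 = 0.
  apply: mxnorm1_eq0; apply/eqP; rewrite eq_le; apply/andP; split; last first.
    by apply: sumr_ge0 => i _; apply: sumr_ge0.
  rewrite -[mxnorm1 _]/(g T0) leNgt; apply/negP => g0.
  (* Entries of matrices in [K] are at most 1 in absolute value, so [mxnorm1] is at most [n^2]
     there; the added 1 keeps [c] positive when [n = 0]. *)
  pose c : R := n%:R * n%:R + 1.
  have c0 : 0 < c by rewrite /c ltr_wpDl // mulr_ge0.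
  have [mu [m0 dmu] mlt] : exists2 mu, Lam mu & mu < mus + g T0 / c.
    by apply: inf_adherent => //; rewrite divr_gt0.
  have mge : mus <= mu by apply: ge_inf.
  have [S pS hS] := decay_resolvent dmu.
  have tS := psd_tr_ge0 pS; have tp : 0 < 1 + \tr S by lra.
  pose T := (1 + \tr S)^-1 *: S.
  have pT : psd T by apply: psdZ; rewrite ?invr_ge0 ?ltW.
  have trT : 1 - \tr T = (1 + \tr S)^-1 by rewrite /T mxtraceZ; field; lra.
  have KT : K T by split => //; rewrite /= trT invr_ge0 ltW.
  have e : h T = (mu - mus) *: T.
    by rewrite /h trT -hS /T linearZ /=; mx_module.
  have := Tmin _ (mem_set KT); rewrite leNgt => /negP; apply.
  have : g T <= (mu - mus) * (n%:R * n%:R).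
    rewrite /g e /mxnorm1.
    have -> : (mu - mus) * (n%:R * n%:R) = \sum_(i < n) \sum_(j < n) (mu - mus).
      by rewrite sumr_const card_ord sumr_const card_ord -natrM mulr_natr mulrnA.
    apply: ler_sum => i _; apply: ler_sum => j _.
    rewrite mxE normrM ger0_norm ?subr_ge0 // ler_piMr ?subr_ge0 //.
    by apply: le_trans (psd_entry_le i j pT) _; rewrite -subr_ge0 trT invr_ge0 ltW.
  move=> h1; apply: le_lt_trans h1 _.
  have h2 : mu - mus < g T0 / c by lra.
  apply: (@le_lt_trans _ _ ((mu - mus) * c)).
    by rewrite ler_wpM2l ?subr_ge0 // /c lerDl.
  by rewrite -ltr_pdivlMr.
have tau0 : 1 - \tr T0 = 0.
  apply/eqP; rewrite eq_le tT0 andbT leNgt; apply/negP => t0.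
  have e : mus *: T0 - lyap A N T0 = (1 - \tr T0) *: 1%:M.
    by apply/eqP; rewrite -subr_eq0 -oppr_eq0; apply/eqP; rewrite -[RHS]hT0 /h; mx_module.
  have pQ : pd ((1 - \tr T0) *: (1%:M : 'M[R]_n)).
    split=> [|v v0]; first by rewrite /Defs.symmetric linearZ /= trmx1.
    by rewrite -/(qf _ v) qfZ mulr_gt0 // qf1_gt0.
  apply: ndm; exists T0; last by rewrite e.
  split=> [|v v0]; first exact: pT0.1.
  (* At a nonzero kernel vector [v] of [T0] the form of [lyap A N T0] would be [- tau |v|^2 < 0],
     against [qf_lyap_ge0]. *)
  rewrite lt_def pT0.2 andbT; apply/eqP => q0.
  have Tv := psd_ker pT0 q0.
  have := qf_lyap_ge0 pT0 Tv.
  have -> : lyap A N T0 = mus *: T0 - (1 - \tr T0) *: 1%:M by rewrite -e; mx_module.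
  rewrite qfD qfN qfZ [qf T0 v]q0 mulr0 add0r oppr_ge0 leNgt => /negP; apply.
  by rewrite qfZ mulr_gt0 // qf1_gt0.
exists mus, T0; split => //.
  by move=> T00; move: tau0; rewrite T00 mxtrace0 subr0 => /eqP; rewrite oner_eq0.
by move: hT0; rewrite /h tau0 scale0r addr0 => /eqP; rewrite subr_eq0 => /eqP.
Qed.

End Fixed.
End Lyapunov.

(** * Duality and detectability criteria for stability *)

Section Stability.
Variable R : realType.

Lemma trmx_lyap_pairing r n (A : 'M[R]_n) (N : 'I_r -> 'M[R]_n) X S :
  \tr (lyap A N X *m S) = \tr (X *m lyap A^T (fun i => (N i)^T) S).
Proof.
rewrite /lyap !mulmxDl !mulmxDr !mxtraceD mulmx_suml mulmx_sumr !raddf_sum /= trmxK.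
congr (_ + _).
  rewrite addrC -!mulmxA; congr (_ + _).
  by rewrite [LHS]mxtrace_mulC !mulmxA.
by apply: eq_bigr => i _; rewrite trmxK -!mulmxA [LHS]mxtrace_mulC !mulmxA.
Qed.

(** The minimum principle applied to [- S], whose image under [- lyap] is the psd matrix [lam S]. *)
Lemma decay0_eigen r n (A : 'M[R]_n) (N : 'I_r -> 'M[R]_n) lam S :
  decay A N 0 -> 0 <= lam -> psd S -> lyap A N S = lam *: S -> S = 0.
Proof.
move=> dA l0 pS e; apply: psd_anti => //; apply: (decay_psd dA).
  by rewrite /Defs.symmetric raddfN /= pS.1.
by rewrite scale0r add0r linearN /= opprK e; apply: psdZ.
Qed.

(** Pairing a Perron eigenmatrix [S] of [lyap A N] with the dual certificate [P] gives
    [- lam tr (P S) <= 0], where a positive definite matrix paired with [S] must be nonnegative, so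
    [S = 0]. *)
Lemma decay0_dual r n (A : 'M[R]_n) (N : 'I_r -> 'M[R]_n) :
  decay A^T (fun i => (N i)^T) 0 -> decay A N 0.
Proof.
move=> [P pP pD]; apply: contrapT => /perron [lam [S [l0 pS S0 e]]]; apply: S0.
apply: (tr_pd_mul_eq0 pD pS); apply/eqP; rewrite eq_le tr_psd_mul ?andbT //; last exact: pd_psd.
rewrite mxtrace_mulC scale0r add0r mulmxN raddfN /= -trmx_lyap_pairing e.
by rewrite -scalemxAl mxtraceZ oppr_le0 mulr_ge0 // tr_psd_mul //; exact: pd_psd.
Qed.

(* A feedback system whose cost certificate is not strict is still stable as
   soon as it agrees with a stable one (A', N') on the states of zero cost M. *)
Lemma decay0_detect r n (A A' : 'M[R]_n) (N N' : 'I_r -> 'M[R]_n) X M :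
  psd X -> psd M -> psd (- (lyap A N X + M)) ->
  (forall lam S, 0 <= lam -> psd S -> lyap A'^T (fun i => (N' i)^T) S = lam *: S -> S = 0) ->
  (forall S : 'M[R]_n, M *m S = 0 -> A *m S = A' *m S /\ forall i, N i *m S = N' i *m S) ->
  decay A N 0.
Proof.
move=> pX pM pXM noeig agree; apply: decay0_dual; apply: contrapT.
move=> /perron [lam [S [l0 pS S0 e]]]; apply: S0; apply: (noeig lam) => //.
(* Zero cost comes from [0 <= lam tr (X S) = tr (lyap A N X S) <= - tr (M S) <= 0]. *)
have h1 : 0 <= \tr (lyap A N X *m S).
  by rewrite trmx_lyap_pairing e -scalemxAr mxtraceZ mulr_ge0 // tr_psd_mul.
have h2 := tr_psd_mul pXM pS; rewrite mulNmx mulmxDl raddfN /= mxtraceD in h2.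
have h3 := tr_psd_mul pM pS.
have /agree [eA eN] : M *m S = 0 by apply: tr_psd_mul_eq0 => //; lra.
have tr1 (B : 'M[R]_n) : S *m B^T = (B *m S)^T by rewrite trmx_mul pS.1.
rewrite -e /lyap !trmxK !tr1 eA; congr (_ + _).
by apply: eq_bigr => i _; rewrite !trmxK eN -!mulmxA !tr1 eN.
Qed.

(** * Complex eigenvalues and noiseless certificates *)

Section Complex.
Local Notation C := R[i].

Definition Remx p q (v : 'M[C]_(p, q)) : 'M[R]_(p, q) := map_mx (@complex.Re R) v.
Definition Immx p q (v : 'M[C]_(p, q)) : 'M[R]_(p, q) := map_mx (@complex.Im R) v.

Lemma cmx_split p q (v : 'M[C]_(p, q)) : v = cmx (Remx v) + 'i%C *: cmx (Immx v).
Proof.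
apply/matrixP => i j; rewrite !mxE; case: (v i j) => a b /=.
by apply/eqP; rewrite eq_complex /= !mul0r !mul1r !(subr0, sub0r, addr0, add0r, oppr0, mul1r, eqxx).
Qed.

Lemma cmxM p q s (M : 'M[R]_(p, q)) (N : 'M[R]_(q, s)) : cmx (M *m N) = cmx M *m cmx N.
Proof. exact: map_mxM. Qed.

Lemma cmx_parts_inj p q (a b c d : 'M[R]_(p, q)) :
  cmx a + 'i%C *: cmx b = cmx c + 'i%C *: cmx d -> a = c /\ b = d.
Proof.
move=> /matrixP h; split; apply/matrixP => i j; have := h i j; rewrite !mxE => /eqP;
by rewrite eq_complex /= !mul0r !mul1r !(subr0, sub0r, addr0, add0r, oppr0, mul1r) => /andP [/eqP ? /eqP ?].
Qed.

Lemma parts_mul p q s (z : 'M[C]_(p, q)) (S : 'M[R]_(q, s)) :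
  Remx (z *m cmx S) = Remx z *m S /\ Immx (z *m cmx S) = Immx z *m S.
Proof.
apply: cmx_parts_inj; rewrite -cmx_split [in LHS](cmx_split z).
by rewrite mulmxDl -scalemxAl -!cmxM.
Qed.

Lemma parts_scale p q (lam : C) (v : 'M[C]_(p, q)) :
  Remx (lam *: v) = complex.Re lam *: Remx v - complex.Im lam *: Immx v /\
  Immx (lam *: v) = complex.Im lam *: Remx v + complex.Re lam *: Immx v.
Proof.
split; apply/matrixP => i j; rewrite !mxE; case: lam (v i j) => x y [a b] /=; ring.
Qed.

Lemma parts_eq0 p q (v : 'M[C]_(p, q)) : Remx v = 0 -> Immx v = 0 -> v = 0.
Proof.
by move=> h1 h2; rewrite (cmx_split v) h1 h2 /cmx !map_mx0 scaler0 addr0.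
Qed.

(** Rows are used because [eigenvalue] speaks of left eigenvectors. *)
Definition rqf n (M : 'M[R]_n) (v : 'rV[R]_n) := (v *m M *m v^T) 0 0.

Lemma rqfE n (M : 'M[R]_n) v : rqf M v = qf M v^T.
Proof. by rewrite /qf trmxK. Qed.

Lemma row_bilin_sym n (M : 'M[R]_n) (u v : 'rV[R]_n) : Defs.symmetric M ->
  (u *m M *m v^T) 0 0 = (v *m M *m u^T) 0 0.
Proof.
move=> sM; have <- : (v *m M *m u^T)^T = u *m M *m v^T by rewrite !trmx_mul trmxK sM mulmxA.
by rewrite mxE.
Qed.

Lemma row_bilin_comb n (M : 'M[R]_n) (u v w : 'rV[R]_n) x y :
  ((x *: u + y *: v) *m M *m w^T) 0 0
  = x * (u *m M *m w^T) 0 0 + y * (v *m M *m w^T) 0 0.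
Proof.
have e (X Y : 'M[R]_1) : (x *: X + y *: Y) 0 0 = x * X 0 0 + y * Y 0 0 by rewrite !mxE.
by rewrite !mulmxDl -!scalemxAl e.
Qed.

(* Since ['I_0] is empty, [N : 'I_0 -> _] expresses the absence of noise. *)
Lemma decay0_eig_in_Cminus n (A : 'M[R]_n) (N : 'I_0 -> 'M[R]_n) :
  decay A N 0 -> eig_in_Cminus A.
Proof.
move=> dA lam /eigenvalueP [v hv v0].
have [P pP pD] : decay A^T (fun i => (N i)^T) 0.
  apply: decay0_dual; rewrite trmxK.
  by have -> : (fun i => ((N i)^T)^T) = N by apply/funext => -[].
have [e1 e2] := parts_mul v A; have [f1 f2] := parts_scale lam v.
rewrite hv in e1 e2; rewrite {}f1 in e1; rewrite {}f2 in e2.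
move: e1 e2 v0; set a := Remx v; set b := Immx v => e1 e2 v0.
set x := complex.Re lam in e1 e2 *; set y := complex.Im lam in e1 e2.
have D u : rqf (0 *: P - lyap A^T (fun i => (N i)^T) P) u = - 2 * (u *m A *m P *m u^T) 0 0.
  rewrite scale0r add0r /lyap big_ord0 addr0 trmxK /rqf mulmxN mulNmx mulmxDr mulmxDl.
  rewrite -[u *m (P *m A^T) *m u^T]trmxK.
  have -> : (u *m (P *m A^T) *m u^T)^T = u *m A *m P *m u^T.
    by rewrite !trmx_mul !trmxK pP.1 !mulmxA.
  rewrite !mulmxA !mxE; ring.
have ge0 u : 0 <= rqf (0 *: P - lyap A^T (fun i => (N i)^T) P) u.
  by rewrite rqfE; have [_ h] := pd_psd pD; exact: h.
have gt0 (Q : 'M[R]_n) u : pd Q -> u != 0 -> 0 < rqf Q u.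
  move=> pQ u0; rewrite rqfE; apply: pQ.2; apply: contra u0 => /eqP h.
  by rewrite -[u]trmxK h trmx0.
have ge0P u : 0 <= rqf P u by rewrite rqfE; have [_ h] := pd_psd pP; exact: h.
(* Adding the real and imaginary parts cancels the terms in [Im lam], by symmetry of [P]. *)
have sum : (a *m A *m P *m a^T) 0 0 + (b *m A *m P *m b^T) 0 0 = x * (rqf P a + rqf P b).
  rewrite -e1 -e2 -scaleNr !row_bilin_comb (row_bilin_sym a b pP.1) /rqf; ring.
have [a0|a0] := eqVneq a 0; last first.
  have := gt0 _ _ pD a0; have := gt0 _ _ pP a0; rewrite D.
  have := ge0 b; rewrite D; have := ge0P b; nra.
have b0 : b != 0 by apply: contra v0 => /eqP b0; apply/eqP/parts_eq0.
have := gt0 _ _ pD b0; have := gt0 _ _ pP b0; rewrite D.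
have := ge0 a; rewrite D; have := ge0P a; nra.
Qed.

(** Otherwise Perron gives [S A = (lam - A^T) S], so the row space of [S] is invariant under [A] and
    contains a complex left eigenvector [w = z S]. Evaluating the forms at the real and imaginary
    parts of [z] equates a multiple of [lam / 2 >= 0] with the same multiple of [Re al < 0], which
    forces [w = 0]. *)
Lemma eig_in_Cminus_decay0 n (A : 'M[R]_n) (N : 'I_0 -> 'M[R]_n) :
  eig_in_Cminus A -> decay A N 0.
Proof.
move=> hA; apply: contrapT => /perron [lam [S [l0 pS S0]]].
rewrite /lyap big_ord0 addr0 => e.
have cS0 : cmx S != 0 by rewrite /cmx map_mx_eq0; apply/eqP.
have stab : stablemx (cmx S) (cmx A).
  have -> : cmx S *m cmx A = cmx (lam%:M - A^T) *m cmx S.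
    by rewrite -!cmxM mulmxBl mul_scalar_mx -e addrC addKr.
  exact: submxMl.
have rk : (0 < \rank (cmx S))%N by rewrite lt0n mxrank_eq0.
have sV : stablemx (row_base (cmx S)) (cmx A) by rewrite stablemx_row_base.
have fV := row_base_free (cmx S).
(* [A] restricted to the row space of [S], in the basis [row_base], has an eigenvalue because the
   complex field is closed. *)
have [al /eigenvalueP [u hu u0]] := eigenvalue_closed (conjmx (row_base (cmx S)) (cmx A)) rk.
set w := u *m row_base (cmx S).
have w0 : w != 0 by rewrite mulmx_free_eq0.
have hw : w *m cmx A = al *: w.
  by apply/eigenspaceP; rewrite -sub_eigenspace_conjmx //; apply/eigenspaceP.
have /submxP [z hz] : (w <= cmx S)%MS.
  by rewrite (submx_trans (submxMl _ _)) // eq_row_base.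
have xneg : complex.Re al < 0 by apply: hA; apply/eigenvalueP; exists w.
have [e1 e2] := parts_mul w A; have [f1 f2] := parts_scale al w.
rewrite hw in e1 e2; rewrite {}f1 in e1; rewrite {}f2 in e2.
have [g1 g2] := parts_mul z S; rewrite -hz in g1 g2.
set x := complex.Re al in e1 e2 xneg; set y := complex.Im al in e1 e2.
set a := Remx w in e1 e2 g1; set b := Immx w in e1 e2 g2.
set c := Remx z in g1; set d := Immx z in g2.
have half u' : 2 * (u' *m S *m A *m u'^T) 0 0 = lam * rqf S u'.
  have : (u' *m (A^T *m S + S *m A) *m u'^T) 0 0 = lam * rqf S u'.
    by rewrite e -scalemxAr -scalemxAl mxE.
  rewrite mulmxDr mulmxDl mxE -[u' *m (A^T *m S) *m u'^T]trmxK.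
  have -> : (u' *m (A^T *m S) *m u'^T)^T = u' *m S *m A *m u'^T.
    by rewrite !trmx_mul !trmxK pS.1 !mulmxA.
  by rewrite mxE mulmxA => <-; rewrite -mulr2n mulr_natl.
have sum : (c *m S *m A *m c^T) 0 0 + (d *m S *m A *m d^T) 0 0 = x * (rqf S c + rqf S d).
  rewrite -g1 -g2 -e1 -e2 g1 g2.
  have comb s t : s *: (c *m S) + t *: (d *m S) = (s *: c + t *: d) *m S.
    by rewrite mulmxDl -!scalemxAl.
  rewrite -scaleNr !comb !row_bilin_comb (row_bilin_sym c d pS.1) /rqf; ring.
have c0 : 0 <= rqf S c by rewrite rqfE; exact: pS.2.
have d0 : 0 <= rqf S d by rewrite rqfE; exact: pS.2.
have hc := half c; have hd := half d.
have rq0 u' : rqf S u' = 0 -> u' *m S = 0.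
  rewrite rqfE => /(psd_ker pS) h.
  by rewrite -[u' *m S]trmxK trmx_mul pS.1 h trmx0.
have c00 : rqf S c = 0 by nra.
have d00 : rqf S d = 0 by nra.
case/eqP: w0; apply: parts_eq0; rewrite -/a -/b; [rewrite g1|rewrite g2]; exact: rq0.
Qed.

End Complex.
End Stability.

(** * Riccati operators, frozen and coupled *)

Section Riccati.
Variable R : realType.

(** [expR (lam * t) *: S] solves the equation without decaying. This brings exponential stability
    into the form required by [decay0_detect]. *)
Lemma exp_stable_ode_eigen p (Lop : 'M[R]_p -> 'M[R]_p) lam S :
  exp_stable_ode Lop -> (forall c T, Lop (c *: T) = c *: Lop T) ->
  0 <= lam -> Lop S = lam *: S -> S = 0.
Proof.
move=> [c [a [c0 [a0 hs]]]] hom l0 e; apply: mxnorm1_eq0; apply/eqP.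
have N0 (T : 'M[R]_p) : 0 <= mxnorm1 T by apply: sumr_ge0 => i _; apply: sumr_ge0.
rewrite eq_le N0 andbT leNgt; apply/negP => Np.
have d (t s : R) : is_derive t 1 (fun x : R => expR (lam * x) * s) (lam * expR (lam * t) * s).
  have h1 : is_derive t 1 ( *%R lam) lam.
    have h := is_deriveZ lam (is_derive_id t (1 : R)).
    by rewrite -[X in is_derive _ _ _ X]mulr1; exact: h.
  have h2 := is_derive1_comp (is_derive_expR (lam * t)) h1.
  apply: (is_derive_eq (is_deriveM h2 (is_derive_cst s t (1 : R)))).
  by rewrite scaler0 add0r /GRing.scale /= mulrC [expR _ * lam]mulrC.
pose Sol (t : R) := expR (lam * t) *: S.
have sol (t : R) (i j : 'I_p) : derivable (fun s : R => Sol s i j) t 1 /\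
    derive1 (fun s : R => Sol s i j) t = Lop (Sol t) i j.
  have -> : (fun s : R => Sol s i j) = fun x => expR (lam * x) * S i j.
    by apply/funext => x; rewrite mxE.
  have [h1 h2] := d t (S i j); split=> //.
  by rewrite derive1E h2 /Sol hom e !mxE mulrA [lam * _]mulrC.
have nS t : mxnorm1 (Sol t) = expR (lam * t) * mxnorm1 S.
  rewrite /mxnorm1 mulr_sumr; apply: eq_bigr => i _; rewrite mulr_sumr.
  by apply: eq_bigr => j _; rewrite mxE normrM ger0_norm // expR_ge0.
(* At time [c / a] the claimed bound has the factor [c exp(- c) < 1]. *)
have t0 : 0 <= c / a by rewrite divr_ge0 // ltW.
have := hs _ sol _ t0; rewrite !nS mulr0 expR0 mul1r ler_pM2r // expRN.
rewrite ler_pdivlMr ?expR_gt0 // leNgt => /negP; apply.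
have ea : c < expR (a * (c / a)).
  rewrite mulrCA divff ?gt_eqF // mulr1.
  by apply: lt_le_trans (expR_ge1Dx c); rewrite ltrDr.
have el : 1 <= expR (lam * (c / a)).
  by apply: le_trans (expR_ge1Dx _); rewrite lerDl mulr_ge0.
by apply: (lt_le_trans ea); rewrite ler_peMl // expR_ge0.
Qed.

(** [V] stands for the inverse of [Rr]. The left side is free of [F], so [F] can be chosen to suit
    each comparison. *)
Lemma complete_square n m (A X Q : 'M[R]_n) (B L : 'M[R]_(n, m)) (V Rr : 'M[R]_m)
    (F : 'M[R]_(m, n)) :
  X^T = X -> V^T = V -> Rr *m V = 1%:M ->
  (A - B *m V *m L^T)^T *m X + X *m (A - B *m V *m L^T)
    - X *m (B *m V *m B^T) *m X + (Q - L *m V *m L^T) =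
  (A + B *m F)^T *m X + X *m (A + B *m F)
    + (Q + L *m F + F^T *m L^T + F^T *m Rr *m F)
    - (F + V *m (X *m B + L)^T)^T *m Rr *m (F + V *m (X *m B + L)^T).
Proof.
move=> sX sV RV.
have VR : V *m Rr = 1%:M by apply: mulmx1C.
have -> : (F + V *m (X *m B + L)^T)^T *m Rr *m (F + V *m (X *m B + L)^T) =
  F^T *m Rr *m F + F^T *m (X *m B + L)^T + (X *m B + L) *m F
  + (X *m B + L) *m V *m (X *m B + L)^T.
  move: (X *m B + L) => W.
  have -> : (F + V *m W^T)^T = F^T + W *m V :> 'M_(n, m).
    by rewrite raddfD /= trmx_mul trmxK sV.
  rewrite !mulmxDl !mulmxDr -!mulmxA [Rr *m (V *m _)]mulmxA RV mul1mx.
  by rewrite [V *m (Rr *m _)]mulmxA VR mul1mx; mx_module.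
have -> : (X *m B + L)^T = B^T *m X + L^T :> 'M_(m, n) by rewrite raddfD /= trmx_mul sX.
have -> : (A - B *m V *m L^T)^T = A^T - L *m V *m B^T :> 'M_n.
  by rewrite raddfB /= !trmx_mul trmxK sV mulmxA.
have -> : (A + B *m F)^T = A^T + F^T *m B^T :> 'M_n by rewrite raddfD /= trmx_mul.
rewrite !(mulmxDl, mulmxDr, mulmxBl, mulmxBr, mulmxN, mulNmx) !mulmxA.
mx_module.
Qed.

Lemma psdD_ker n k (M N : 'M[R]_n) (S : 'M[R]_(n, k)) : psd M -> psd N ->
  (M + N) *m S = 0 -> M *m S = 0 /\ N *m S = 0.
Proof.
move=> pM pN h.
have z v : qf M (S *m v) = 0 /\ qf N (S *m v) = 0.
  have : qf (M + N) (S *m v) = 0 by rewrite /qf -mulmxA [(M + N) *m _]mulmxA h mul0mx mulmx0 mxE.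
  have h1 : 0 <= qf M (S *m v) := pM.2 _.
  have h2 : 0 <= qf N (S *m v) := pN.2 _.
  by rewrite qfD; split; lra.
by split; apply: mulmx_col_eq0 => v; rewrite mul0mx -mulmxA; apply: psd_ker => //; case: (z v).
Qed.

Lemma pd_congr_ker n m k (M : 'M[R]_m) (G : 'M[R]_(m, n)) (S : 'M[R]_(n, k)) :
  pd M -> G^T *m M *m G *m S = 0 -> G *m S = 0.
Proof.
move=> pM h; apply: mulmx_col_eq0 => v; rewrite mul0mx.
apply/eqP; apply: contraT => /(pM.2); rewrite -[X in 0 < X -> _]/(qf M _) -mulmxA -qf_congr.
by rewrite /qf -mulmxA [G^T *m M *m G *m _]mulmxA h mul0mx mulmx0 mxE ltxx.
Qed.

Section Equation.
Variables (n m r : nat).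
Variables (A : 'M[R]_n) (B : 'M[R]_(n, m)) (Q : 'M[R]_n) (L : 'M[R]_(n, m))
  (Rm : 'M[R]_m) (A0 : 'I_r -> 'M[R]_n) (B0 : 'I_r -> 'M[R]_(n, m)).

Local Notation Ac := (Ac A B L Rm A0 B0).
Local Notation Gc := (Gc B Rm B0).
Local Notation Hc := (Hc Q L Rm A0 B0).
Local Notation Rc := (Rc Rm B0).
Local Notation Lc := (Lc L A0 B0).
Local Notation Qc := (Qc Q A0).
Local Notation Ric := (Ric A B Q L Rm A0 B0).

(* [Ric X] is [frozen_ric X X] by conversion, so identities for [frozen_ric]
   also serve for [Ric]. *)
Definition frozen_ric (Z X : 'M[R]_n) : 'M[R]_n :=
  (Ac Z)^T *m X + X *m Ac Z - X *m Gc Z *m X + Hc Z.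

(** The feedback at which the square of [complete_square] vanishes, for the weights frozen at
    [Z]. *)
Definition gain (Z X : 'M[R]_n) : 'M[R]_(m, n) :=
  - (invmx (Rc Z) *m (X *m B + Lc Z)^T).

Definition loop (F : 'M[R]_(m, n)) : 'M[R]_n := A + B *m F.
Definition loop_noise (F : 'M[R]_(m, n)) (i : 'I_r) : 'M[R]_n := A0 i + B0 i *m F.
Definition noise (F : 'M[R]_(m, n)) (Z : 'M[R]_n) : 'M[R]_n :=
  \sum_i (loop_noise F i)^T *m Z *m loop_noise F i.
(* The value [1; F]^T [[Q, L]; [L^T, Rm]] [1; F] of the running cost under u = F x. *)
Definition cost (F : 'M[R]_(m, n)) : 'M[R]_n :=
  Q + L *m F + F^T *m L^T + F^T *m Rm *m F.

Lemma loop_gain Z X : Defs.symmetric X -> loop (gain Z X) = Ac Z - Gc Z *m X.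
Proof.
move=> sX; rewrite /loop /gain /Defs.Ac /Defs.Gc.
have -> : (X *m B + Lc Z)^T = B^T *m X + (Lc Z)^T :> 'M_(m, n) by rewrite raddfD /= trmx_mul sX.
by rewrite mulmxN mulmxDr mulmxDr !mulmxA opprD addrCA addrC -addrA [_ - B *m _ *m B^T *m _]addrC.
Qed.

(** Freezing the noise at [Z] amounts to replacing the weights [Q], [L], [Rm] of the running cost by
    [Qc Z], [Lc Z], [Rc Z]. *)
Lemma cost_noise F Z : Defs.symmetric Z ->
  cost F + noise F Z = Qc Z + Lc Z *m F + F^T *m (Lc Z)^T + F^T *m Rc Z *m F.
Proof.
move=> sZ; rewrite /cost /Defs.Qc /Defs.Lc /Defs.Rc.
have -> : noise F Z = Pi11 A0 Z + Pi12 A0 B0 Z *m F + F^T *m (Pi12 A0 B0 Z)^T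
    + F^T *m Pi22 B0 Z *m F.
  rewrite /noise /Pi11 /Pi12 /Pi22 raddf_sum /= !mulmx_sumr !mulmx_suml -!big_split /=.
  apply: eq_bigr => i _; rewrite /loop_noise.
  have -> : (A0 i + B0 i *m F)^T = (A0 i)^T + F^T *m (B0 i)^T :> 'M_n by rewrite raddfD /= trmx_mul.
  have -> : ((A0 i)^T *m Z *m B0 i)^T = (B0 i)^T *m Z *m A0 i.
    by rewrite !trmx_mul trmxK sZ mulmxA.
  by rewrite !(mulmxDl, mulmxDr) !mulmxA; mx_module.
have -> : (L + Pi12 A0 B0 Z)^T = L^T + (Pi12 A0 B0 Z)^T :> 'M_(m, n) by rewrite raddfD.
by rewrite !(mulmxDl, mulmxDr); move: (Pi11 _ _) => P; mx_module.
Qed.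

Hypothesis pR : pd Rm.

Lemma pd_Rc Z : psd Z -> pd (Rc Z).
Proof. by move=> pZ; apply: pd_psdD => //; apply: psd_sum => i; exact: psd_congr. Qed.

(** Apart from the square, [Z] enters only through [noise F Z], which is additive and monotone in
    [Z]. *)
Lemma frozen_ricE F Z X : psd Z -> Defs.symmetric X ->
  frozen_ric Z X = (loop F)^T *m X + X *m loop F + cost F + noise F Z
    - (F - gain Z X)^T *m Rc Z *m (F - gain Z X).
Proof.
move=> pZ sX; have pRc := pd_Rc pZ; have u := pd_unitmx pRc.
rewrite -addrA -addrA [cost F + _]addrA (cost_noise F pZ.1) addrA /gain opprK.
apply: complete_square => //; last exact: mulmxV.
by rewrite trmx_inv pRc.1.
Qed.

Lemma frozen_ric_gain Z X : psd Z -> Defs.symmetric X ->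
  frozen_ric Z X = (loop (gain Z X))^T *m X + X *m loop (gain Z X)
    + cost (gain Z X) + noise (gain Z X) Z.
Proof. by move=> pZ sX; rewrite (frozen_ricE (gain Z X)) // subrr mulmx0 subr0. Qed.

Lemma psd_noise F Z : psd Z -> psd (noise F Z).
Proof. by move=> pZ; apply: psd_sum => i; exact: psd_congr. Qed.

Lemma noiseB F Z Y : noise F (Z - Y) = noise F Z - noise F Y.
Proof.
by rewrite /noise -sumrB; apply: eq_bigr => i _; rewrite mulmxBr mulmxBl.
Qed.

Lemma costE F : Defs.symmetric Q ->
  cost F = (Q - L *m invmx Rm *m L^T)
    + (F + invmx Rm *m L^T)^T *m Rm *m (F + invmx Rm *m L^T).
Proof.
move=> sQ; have u := pd_unitmx pR.
have -> : (F + invmx Rm *m L^T)^T = F^T + L *m invmx Rm :> 'M_(n, m).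
  by rewrite raddfD /= trmx_mul trmxK trmx_inv pR.1.
rewrite !(mulmxDl, mulmxDr) /cost !mulmxA mulmxKV // -[F^T *m Rm *m invmx Rm]mulmxA mulmxV //.
by rewrite mulmx1; mx_module.
Qed.


Local Notation Qt := (Q - L *m invmx Rm *m L^T).

Hypotheses (sQ : Defs.symmetric Q) (pQt : psd Qt).

Lemma psd_Rc_square Z (G : 'M[R]_(m, n)) : psd Z -> psd (G^T *m Rc Z *m G).
Proof. by move=> pZ; apply/psd_congr/pd_psd/pd_Rc. Qed.

Lemma psd_cost F : psd (cost F).
Proof. by rewrite costE //; apply: psdD => //; apply/psd_congr/pd_psd. Qed.

(** Both psd terms of [costE] vanish on [S], so [F] acts there as [- Rm^-1 L^T], the feedback built
    into [ms_detectable]. *)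
Lemma cost_ker F (S : 'M[R]_n) : cost F *m S = 0 ->
  Qt *m S = 0 /\ F *m S = - (invmx Rm *m L^T *m S).
Proof.
rewrite costE // => /psdD_ker [] //; first exact/psd_congr/pd_psd.
move=> h1 /(pd_congr_ker pR); rewrite mulmxDl => /eqP; rewrite addr_eq0 => /eqP h2.
by split.
Qed.

Lemma mxcvg_frozen_ric (X Y : nat -> 'M[R]_n) Xo Yo :
  (forall k, psd (X k)) -> psd Xo -> mxcvg \oo X Xo -> mxcvg \oo Y Yo ->
  mxcvg \oo (fun k => frozen_ric (X k) (Y k)) (frozen_ric Xo Yo).
Proof.
move=> pX pXo hX hY.
have cst p q (M : 'M[R]_(p, q)) : mxcvg \oo (fun=> M) M by exact: mxcvg_cst.
have cL : mxcvg \oo (fun k => Lc (X k)) (Lc Xo).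
  apply: mxcvgD => //; apply: mxcvg_sum => i.
  by apply: mxcvgM => //; apply: mxcvgM.
have cV : mxcvg \oo (fun k => invmx (Rc (X k))) (invmx (Rc Xo)).
  apply: mxcvg_inv => [k||]; [exact/pd_unitmx/pd_Rc | exact/pd_unitmx/pd_Rc |].
  apply: mxcvgD => //; apply: mxcvg_sum => i.
  by apply: mxcvgM => //; apply: mxcvgM.
have cA : mxcvg \oo (fun k => Ac (X k)) (Ac Xo).
  apply: mxcvgD => //; apply: mxcvgN; apply: mxcvgM; last exact: mxcvgT.
  exact: mxcvgM.
have cG : mxcvg \oo (fun k => Gc (X k)) (Gc Xo) by apply: mxcvgM => //; exact: mxcvgM.
apply: mxcvgD; [apply: mxcvgD; [apply: mxcvgD|]|].
- by apply: mxcvgM => //; exact: mxcvgT.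
- exact: mxcvgM.
- by apply: mxcvgN; apply: mxcvgM => //; exact: mxcvgM.
apply: mxcvgD; last by apply: mxcvgN; apply: mxcvgM; [exact: mxcvgM | exact: mxcvgT].
apply: mxcvgD => //; apply: mxcvg_sum => i.
by apply: mxcvgM => //; apply: mxcvgM.
Qed.

Section Detectable.
Variables (p : nat) (C : 'M[R]_(p, n)).
Hypotheses (CC : C^T *m C = Qt) (det : ms_detectable A B L Rm A0 B0 C).

(** [X] itself serves in [decay0_detect], as [lyap X + cost = Ric X = 0]. On zero-cost states
    [C S = 0], so the loop agrees with the system stabilised by output injection. *)
Lemma solution_ms_stable X : psd X -> Ric X = 0 ->
  decay (loop (gain X X)) (loop_noise (gain X X)) 0.
Proof.
move=> pX rX; have [K hK] := det.
set F := gain X X.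
apply: (@decay0_detect _ _ _ _ (A - B *m invmx Rm *m L^T + K *m C) _
  (fun i => A0 i - B0 i *m invmx Rm *m L^T) X (cost F)) => //.
- exact: psd_cost.
- have -> : lyap (loop F) (loop_noise F) X + cost F = Ric X.
    rewrite -[Ric X]/(frozen_ric X X) frozen_ric_gain //; last exact: pX.1.
    by rewrite /lyap -/F [RHS]addrAC.
  by rewrite rX oppr0; exact: psd0.
- move=> lam S l0 pS e; apply: (exp_stable_ode_eigen hK _ l0).
    move=> c T /=; rewrite -scalemxAl -scalemxAr !scalerDr scaler_sumr; congr (_ + _).
    by apply: eq_bigr => i _; rewrite -scalemxAr -scalemxAl.
  rewrite -e /lyap trmxK; congr (_ + _).
  by apply: eq_bigr => i _; rewrite trmxK.
move=> S /cost_ker [h1 h2].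
have CS : C *m S = 0.
  apply: (pd_congr_ker (pd1 R p)); rewrite mulmx1 CC; exact: h1.
by split=> [|i]; rewrite /loop /loop_noise !mulmxDl ?mulNmx -?mulmxA h2 ?CS ?mulmx0 ?addr0 mulmxN !mulmxA.
Qed.

End Detectable.

Section Frozen.
Variables (K : 'M[R]_n) (Xs : 'M[R]_n).
Hypotheses (ker : forall v : 'cV[R]_n, Qt *m v = 0 -> L^T *m v = 0)
  (hK : eig_in_Cminus (A + K *m Qt)) (pXs : psd Xs) (rXs : Ric Xs = 0).

(** Compare with [Ric Xs = 0] along the gain of [Xs]: freezing at [Z <= Xs] loses
    [noise F (Xs - Z)], and a square is subtracted as well. *)
Lemma frozen_ric_solution_le0 Z : psd Z -> loewner_le Z Xs -> psd (- frozen_ric Z Xs).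
Proof.
move=> pZ le; set F := gain Xs Xs.
have e1 : (loop F)^T *m Xs + Xs *m loop F + cost F + noise F Xs = 0.
  by rewrite -frozen_ric_gain //; exact: pXs.1.
have -> : - frozen_ric Z Xs = noise F (Xs - Z) + (F - gain Z Xs)^T *m Rc Z *m (F - gain Z Xs).
  rewrite (frozen_ricE F pZ pXs.1) noiseB.
  move: e1; move: (noise F Xs) (noise F Z) (cost F) => U V W e1.
  have -> : U = - ((loop F)^T *m Xs + Xs *m loop F + W).
    by apply/eqP; rewrite -addr_eq0 addrC; apply/eqP.
  mx_module.
by apply: psdD; [exact: psd_noise | exact: psd_Rc_square].
Qed.

(** The reference system is [A + K Qt]. On zero-cost states [Qt S = 0], the kernel inclusion gives
    [L^T S = 0], hence [F S = 0], and both matrices act as [A]. *)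
Lemma frozen_loop_stable Z (N : 'I_0 -> 'M[R]_n) :
  psd Z -> loewner_le Z Xs -> decay (loop (gain Z Xs)) N 0.
Proof.
move=> pZ le; set F := gain Z Xs.
apply: (@decay0_detect _ _ _ _ (A + K *m Qt) _ N Xs (cost F)) => //.
- exact: psd_cost.
- have -> : - (lyap (loop F) N Xs + cost F) = - frozen_ric Z Xs + noise F Z.
    rewrite frozen_ric_gain //; last exact: pXs.1.
    by rewrite /lyap big_ord0 addr0 -/F; move: (noise F Z) => U; mx_module.
  by apply: psdD; [exact: frozen_ric_solution_le0 | exact: psd_noise].
- move=> lam S l0 pS; apply: decay0_eigen => //; apply: decay0_dual; rewrite trmxK.
  exact: eig_in_Cminus_decay0.
move=> S /cost_ker [h1 h2]; split; last by case.
have LS : L^T *m S = 0.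
  by apply: mulmx_col_eq0 => v; rewrite mul0mx -mulmxA; apply: ker; rewrite mulmxA h1 mul0mx.
by rewrite /loop !mulmxDl -[B *m F *m S]mulmxA h2 -mulmxA LS -mulmxA h1 !mulmx0 oppr0 mulmx0.
Qed.

Lemma lyapunov_psd (D Y : 'M[R]_n) (N : 'I_0 -> 'M[R]_n) :
  decay D N 0 -> Defs.symmetric Y -> psd (- (D^T *m Y + Y *m D)) -> psd Y.
Proof.
move=> dD sY h; apply: (decay_psd dD sY).
by rewrite scale0r add0r /lyap big_ord0 addr0.
Qed.

(** The induction step: [psd (Ric Z)] yields [Z <= X], which in turn yields [psd (Ric X)]. *)
Lemma frozen_step Z X :
  psd Z -> loewner_le Z Xs -> psd (Ric Z) ->
  frozen_stabilizing_sol (Ac Z) (Gc Z) (Hc Z) X ->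
  [/\ loewner_le Z X, loewner_le X Xs & psd (Ric X)].
Proof.
move=> pZ le rZ [sX [eX stX]].
have {}eX : frozen_ric Z X = 0 by [].
pose N := fun _ : 'I_0 => 0 : 'M[R]_n.
(* A Lyapunov inequality along [gain Z X], whose loop is stable because [X] is stabilizing. *)
have ZX : loewner_le Z X.
  have dX : decay (loop (gain Z X)) N 0.
    by rewrite loop_gain //; exact: eig_in_Cminus_decay0.
  set F := gain Z X in dX.
  apply: (lyapunov_psd dX); first by rewrite /Defs.symmetric raddfB /= sX pZ.1.
  have -> : - ((loop F)^T *m (X - Z) + (X - Z) *m loop F) =
    Ric Z + (F - gain Z Z)^T *m Rc Z *m (F - gain Z Z).
    move: eX; rewrite frozen_ric_gain // -/F => eX.
    rewrite -[Ric Z]/(frozen_ric Z Z) (frozen_ricE F pZ pZ.1) subrK.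
    move: eX; move: (noise F Z) (cost F) => U W eX.
    have -> : U = - ((loop F)^T *m X + X *m loop F + W).
      by apply/eqP; rewrite -addr_eq0 addrC; apply/eqP.
    by rewrite !mulmxBr mulmxBl; mx_module.
  by apply: psdD => //; exact: psd_Rc_square.
(* The same along [gain Z Xs], with [frozen_ric Z Xs <= 0] in place of [Ric Z >= 0]. *)
have XXs : loewner_le X Xs.
  have dX := frozen_loop_stable N pZ le.
  set F := gain Z Xs in dX.
  apply: (lyapunov_psd dX); first by rewrite /Defs.symmetric raddfB /= sX pXs.1.
  have -> : - ((loop F)^T *m (Xs - X) + (Xs - X) *m loop F) =
    - frozen_ric Z Xs + (F - gain Z X)^T *m Rc Z *m (F - gain Z X).
    move: eX; rewrite (frozen_ricE F pZ sX) => eX.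
    rewrite frozen_ric_gain // -/F; last exact: pXs.1.
    move: eX; move: (noise F Z) (cost F) (_ *m (F - gain Z X)) => U W V eX.
    have -> : V = (loop F)^T *m X + X *m loop F + W + U.
      by apply/esym/eqP; rewrite -subr_eq0; apply/eqP.
    by rewrite !mulmxBr mulmxBl; mx_module.
  by apply: psdD; [exact: frozen_ric_solution_le0 | exact: psd_Rc_square].
split; [exact: ZX | exact: XXs |].
have pX : psd X by have := psdD pZ ZX; rewrite addrC subrK.
set F := gain X X.
(* At the common gain [F] the Lyapunov and cost terms of [frozen_ric X X] and [frozen_ric Z X]
   cancel. *)
have -> : Ric X = noise F (X - Z) + (F - gain Z X)^T *m Rc Z *m (F - gain Z X).
  rewrite -[Ric X]/(frozen_ric X X) frozen_ric_gain // -/F noiseB.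
  move: eX; rewrite (frozen_ricE F pZ sX).
  move: (noise F Z) (cost F) (_ *m (F - gain Z X)) => U W V eX.
  have -> : V = (loop F)^T *m X + X *m loop F + W + U.
    by apply/esym/eqP; rewrite -subr_eq0; apply/eqP.
  by move: (noise F X) => T; mx_module.
by apply: psdD; [exact: psd_noise | exact: psd_Rc_square].
Qed.

Lemma frozen_loop_eig Z : psd Z -> loewner_le Z Xs ->
  eig_in_Cminus (Ac Z - Gc Z *m Xs).
Proof.
move=> pZ le; rewrite -loop_gain; last exact: pXs.1.
exact: (decay0_eig_in_Cminus (frozen_loop_stable (fun=> 0) pZ le)).
Qed.

End Frozen.

(* Along the gain of the stable solution [X], the two Riccati equations leave a
   Lyapunov inequality for X - Y. *)
Lemma stable_solution_max X Y : psd X -> psd Y -> Ric X = 0 -> Ric Y = 0 ->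
  decay (loop (gain X X)) (loop_noise (gain X X)) 0 -> loewner_le Y X.
Proof.
move=> pX pY rX rY; set F := gain X X => dF.
apply: (decay_psd dF); first by rewrite /Defs.symmetric raddfB /= pX.1 pY.1.
have -> : 0 *: (X - Y) - lyap (loop F) (loop_noise F) (X - Y)
  = (F - gain Y Y)^T *m Rc Y *m (F - gain Y Y).
  have e1 : frozen_ric X X = 0 by [].
  have e2 : frozen_ric Y Y = 0 by [].
  move: e1; rewrite frozen_ric_gain // -/F; last exact: pX.1.
  move: e2; rewrite (frozen_ricE F pY pY.1).
  rewrite /lyap -/(noise F _) noiseB.
  move: (noise F X) (noise F Y) (cost F) (_ *m (F - gain Y Y)) => U U' W V e1 e2.
  have -> : V = (loop F)^T *m Y + Y *m loop F + W + U'.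
    by apply/esym/eqP; rewrite -subr_eq0; apply/eqP.
  have -> : U = - ((loop F)^T *m X + X *m loop F + W).
    by apply/eqP; rewrite -addr_eq0 addrC; apply/eqP.
  by rewrite !mulmxBr mulmxBl; mx_module.
exact: psd_Rc_square.
Qed.

End Equation.
End Riccati.

(** * Monotone convergence of the fixed-point iteration *)

Theorem theorem3p2 (R : realType) (n m r : nat)
  (A : 'M[R]_n) (B : 'M[R]_(n, m)) (Q : 'M[R]_n) (L : 'M[R]_(n, m))
  (Rm : 'M[R]_m) (A0 : 'I_r -> 'M[R]_n) (B0 : 'I_r -> 'M[R]_(n, m))
  (p : nat) (C : 'M[R]_(p, n))
  (Xs : 'M[R]_n) (X : nat -> 'M[R]_n) :
  standing_assumptions A B Q L Rm A0 B0 ->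
  C^T *m C = Q - L *m invmx Rm *m L^T ->
  ms_detectable A B L Rm A0 B0 C ->
  psd Xs -> Ric A B Q L Rm A0 B0 Xs = 0 ->
  fp_iteration A B Q L Rm A0 B0 X ->
  (* (i) *)
  (forall k : nat,
      loewner_le (X k) (X k.+1) /\
      loewner_le (X k) Xs /\
      psd (Ric A B Q L Rm A0 B0 (X k)) /\
      eig_in_Cminus (Ac A B L Rm A0 B0 (X k) - Gc B Rm B0 (X k) *m Xs)) /\
  (* (ii) *)
  (psd Xs /\
   (forall i j : 'I_n, (fun k : nat => X k i j) @ \oo --> Xs i j) /\
   eig_in_Cminus_or_iR (Ac A B L Rm A0 B0 Xs - Gc B Rm B0 Xs *m Xs)).
Proof.
move=> [sQ [_ [pR [_ [ker0 [_ [[K hK] _]]]]]]] CC det pXs rXs [X0 stepX].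
have ker (v : 'cV[R]_n) : (Q - L *m invmx Rm *m L^T) *m v = 0 -> L^T *m v = 0.
  by move=> h; case: (ker0 v h).
have pQt : psd (Q - L *m invmx Rm *m L^T) by rewrite -CC; exact: psd_gram.
have inv k : [/\ psd (X k), loewner_le (X k) Xs & psd (Ric A B Q L Rm A0 B0 (X k))].
  elim: k => [|k [pX le rX]].
    rewrite X0; split; [exact: psd0 | by rewrite /loewner_le subr0 |].
    (* At zero only the constant term remains: [Ric 0] is [Q - L Rm^-1 L^T]. *)
    rewrite /Ric !(mulmx0, mul0mx) subr0 !add0r.
    rewrite /Hc /Qc /Lc /Rc /Pi11 /Pi12 /Pi22.
    by rewrite !big1 ?addr0 // => i _; rewrite mulmx0 mul0mx.
  have [ZX h1 h2] := frozen_step pR sQ pQt ker hK pXs rXs pX le rX (stepX k).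
  by split=> //; have := psdD pX ZX; rewrite addrC subrK.
have mono k : loewner_le (X k) (X k.+1).
  have [pX le rX] := inv k.
  by have [] := frozen_step pR sQ pQt ker hK pXs rXs pX le rX (stepX k).
have pX k : psd (X k) by have [] := inv k.
have le k : loewner_le (X k) Xs by have [] := inv k.
split.
  move=> k; have [_ _ rX] := inv k; split; [exact: mono | split; [exact: le | split; [exact: rX |]]].
  exact: (frozen_loop_eig pR sQ pQt ker hK pXs rXs (pX k) (le k)).
split; [exact: pXs | split; last first].
  (* Freezing at [Z = Xs] places the spectrum even in the open half plane. *)
  move=> lam h; apply: ltW.
  by apply: (frozen_loop_eig pR sQ pQt ker hK pXs rXs pXs _ h); rewrite /loewner_le subrr; exact: psd0.
have [Xo [cX pXo leo]] := monotone_limit pX mono le.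
have cX1 : mxcvg \oo (fun k => X k.+1) Xo.
  by move=> i j; have := cX i j; rewrite -(cvg_shiftS (fun k => X k i j)).
have rXo : Ric A B Q L Rm A0 B0 Xo = 0.
  have : mxcvg \oo (fun k => frozen_ric A B Q L Rm A0 B0 (X k) (X k.+1))
      (frozen_ric A B Q L Rm A0 B0 Xo Xo) by exact: mxcvg_frozen_ric.
  have -> : (fun k => frozen_ric A B Q L Rm A0 B0 (X k) (X k.+1)) = fun=> 0.
    by apply/funext => k; have [_ []] := stepX k.
  by move=> h; apply: (mxcvg_unique h); exact: mxcvg_cst.
have ms := solution_ms_stable pR sQ pQt CC det pXo rXo.
have <- : Xo = Xs.
  by apply: (loewner_anti leo); exact: (stable_solution_max pR pXo pXs rXo rXs ms).
exact: cX.
Qed.
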